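(* Consider the first order semi-implicit time discretization, with space kept continuous, of the dimensionless shallow water equations with bottom topography $b=b(\mathbf x)$ and Froude number $\varepsilon$: $$\left\{\begin{aligned}&\frac{h^{n+1}-h^n}{\Delta t}+\nabla\cdot(h\mathbf u)^n-\Delta t\,\nabla^2:\Big(\frac{h\mathbf u\otimes h\mathbf u}{h}\Big)^n-\Delta t\,\nabla\cdot\big(h^n\nabla H_2^{n+1}\big)=0,\\&\frac{(h\mathbf u)^{n+1}-(h\mathbf u)^n}{\Delta t}+\nabla\cdot\Big(\frac{h\mathbf u\otimes h\mathbf u}{h}\Big)^n+h^n\nabla H_2^{n+1}=0,\end{aligned}\right.$$ where $H_2^{n+1}$ is defined by $h^{n+1}+b=H^{n+1}=\bar H^n+\varepsilon^2H_2^{n+1}$ and $\bar H^n$ is the spatial average of $H^n=h^n+b$. This scheme is asymptotic preserving, in the sense that, with no-slip or periodic boundary condition, at the leading order of the asymptotic expansions in $\varepsilon$, the scheme is a consistent approximation of the lake equations $$\nabla\cdot(h_0\mathbf u_0)=0,\qquad h_0+b=H_0=\text{Const.},\qquad \partial_t(h_0\mathbf u_0)+\nabla\cdot(h_0\mathbf u_0\otimes\mathbf u_0)+h_0\nabla h_2=0$$ at the zero Froude number limit.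
   Context: The dimensionless shallow water equations are $h_t+\nabla\cdot(h\mathbf u)=0$, $(h\mathbf u)_t+\nabla\cdot(h\mathbf u\otimes\mathbf u)+\frac1{\varepsilon^2}h\nabla H=0$ on a spatial domain $\Omega$, where $h$ is the water depth (no dry areas), $\mathbf u$ the velocity, $b=b(\mathbf x)$ the time-independent bottom, and $H=h+b$ the water surface level. No-slip means $\mathbf u\cdot\mathbf n=0$ on $\partial\Omega$, with $\mathbf n$ the unit outward normal. Superscript $n$ denotes the value at time $t^n$, with $t^{n+1}=t^n+\Delta t$; $\otimes$ is the tensor product and $\nabla^2:M=\sum_{k,l}\partial_k\partial_lM_{kl}$. The asymptotic expansions are expansions in powers of $\varepsilon$, $h=h_0+\varepsilon h_1+\varepsilon^2h_2+\cdots$, $\mathbf u=\mathbf u_0+\varepsilon\mathbf u_1+\varepsilon^2\mathbf u_2+\cdots$. Inserting them in the shallow water equations with no-slip or periodic boundary conditions gives that $h_0+b=H_0$ and $h_1$ are constants in space and time and that the leading order terms satisfy the lake equations, which are the zero Froude number limit. The statement is formal: time is discretized and space is kept continuous. *)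

(* Defs.v *)
From HB Require Import structures.
From mathcomp Require Import all_boot all_order all_algebra.
From mathcomp Require Import all_classical all_reals all_analysis.

Set Implicit Arguments.
Unset Strict Implicit.
Unset Printing Implicit Defensive.

Import Order.TTheory GRing.Theory Num.Theory.
Import numFieldNormedType.Exports.

Local Open Scope classical_set_scope.
Local Open Scope ring_scope.

(* [Ck D D k f] is f \in C^k(D), and [Ck D (closure D) k f] is
   f \in C^k(\bar D): the derivatives are taken at the points of the open set D
   and extend continuously to K. *)
Fixpoint Ck (R : realType) (W X : normedModType R) (D K : set W) (k : nat)
    (f : W -> X) : Prop :=
  {within K, continuous f} /\
  match k with
  | 0%N => True
  | k'.+1 => forall v : W, exists g : W -> X,
      Ck D K k' g /\ (forall x, D x -> is_derive x v f (g x))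
  end.

Notation borel R d := (g_sigma_algebraType (@open 'rV[R]_d)) (only parsing).

Section DifferentialOperators.
Context {R : realType} {d : nat}.
Notation V := 'rV[R]_d.

Definition pd (i : 'I_d) (f : V -> R) : V -> R := 'D_(delta_mx 0 i) f.

Definition grad (f : V -> R) (x : V) : V := \row_i pd i f x.

Definition div (F : V -> V) (x : V) : R := \sum_i pd i (fun y => F y 0 i) x.

Definition div_mx (M : V -> 'M[R]_d) (x : V) : V :=
  \row_k \sum_l pd l (fun y => M y k l) x.

(* \nabla^2 : M *)
Definition ddiv (M : V -> 'M[R]_d) (x : V) : R :=
  \sum_k \sum_l pd k (pd l (fun y => M y k l)) x.

Definition tensor (v w : V) : 'M[R]_d := v^T *m w.

Definition dot (v w : V) : R := \sum_i v 0 i * w 0 i.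

Definition enorm (v : V) : R := Num.sqrt (dot v v).

End DifferentialOperators.

Section Domains.
Context {R : realType} {d : nat}.
Notation V := 'rV[R]_d.

(* y is a boundary point near which the open set Omega is {phi < 0} for some
   phi of class C^1 with nonzero gradient at y. *)
Definition outward_unit_normal (Omega : set V) (y nu : V) : Prop :=
  exists (U : set V) (phi : V -> R),
    [/\ open U, U y & Ck U U 1 phi] /\
    [/\ phi y = 0,
        grad phi y != 0,
        (forall x, U x -> (Omega x <-> phi x < 0))
      & nu = (enorm (grad phi y))^-1 *: grad phi y].

(* For a compact set E, this says that the (d-1)-dimensional Hausdorff measure
   of E is 0. *)
Definition surface_null (E : set V) : Prop :=
  forall eta : R, 0 < eta ->
  exists (m : nat) (c : 'I_m -> V) (r : 'I_m -> R),
    [/\ forall i, 0 < r i < eta,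
        E `<=` \bigcup_i ball (c i) (r i)
      & \sum_i r i ^+ d.-1 < eta].

(* Bounded domains with piecewise C^1 boundary: the boundary points with no
   normal (corners and edges) are allowed if they have no surface measure. *)
Definition regular_domain (Omega : set V) : Prop :=
  [/\ open Omega, connected Omega, bounded_set Omega & Omega !=set0] /\
  surface_null [set y | (closure Omega `\` Omega) y /\
                        ~ exists nu, outward_unit_normal Omega y nu].

Definition periodic (L : V) (X : Type) (f : V -> X) : Prop :=
  forall x i, f (x + L 0 i *: delta_mx 0 i) = f x.

Variant setting :=
  | NoSlip of set V
  | Periodic of V. (* the vector of the periods *)

Definition setting_ok (s : setting) : Prop :=
  match s with
  | NoSlip Omega => regular_domain Omega
  | Periodic L => forall i, 0 < L 0 i
  end.

(* Periodic functions are functions on the whole space. *)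
Definition region (s : setting) : set V :=
  match s with NoSlip Omega => Omega | Periodic _ => setT end.

(* The set over which the spatial average is taken. *)
Definition cell (s : setting) : set V :=
  match s with
  | NoSlip Omega => Omega
  | Periodic L => [set x | forall i, 0 <= x 0 i < L 0 i]
  end.

Definition field_on (s : setting) (X : Type) (f : V -> X) : Prop :=
  match s with NoSlip _ => True | Periodic L => periodic L f end.

Definition boundary_condition (s : setting) (h : V -> R) (u : V -> V) : Prop :=
  match s with
  | NoSlip Omega => forall y nu, outward_unit_normal Omega y nu ->
      dot (u y) nu = 0
  | Periodic L => periodic L h /\ periodic L u
  end.

(* This determines mu: the boxes are a pi-system generating the Borel sets. *)
Definition is_lebesgue (mu : {measure set (borel R d) -> \bar R}) : Prop :=
  forall a b : V, (forall i, a 0 i <= b 0 i) ->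
    mu [set x : V | forall i, a 0 i <= x 0 i < b 0 i]
    = (\prod_i (b 0 i - a 0 i))%:E.

Definition mean (mu : {measure set (borel R d) -> \bar R}) (A : set V)
    (f : V -> R) : R :=
  Rintegral mu A f / fine (mu A).

End Domains.

Arguments setting : clear implicits.

Section Scheme.
Context {R : realType} {d : nat}.
Notation V := 'rV[R]_d.
Variables (s : setting R d) (mu : {measure set (borel R d) -> \bar R}).
Variable b : V -> R.

Definition discharge (h : V -> R) (u : V -> V) (x : V) : V := h x *: u x.

(* (hu \otimes hu) / h *)
Definition flux (h : V -> R) (u : V -> V) (x : V) : 'M[R]_d :=
  (h x)^-1 *: tensor (discharge h u x) (discharge h u x).

(* H_2^{n+1}, from h = h^n and h' = h^{n+1} *)
Definition H2 (eps : R) (h h' : V -> R) (x : V) : R :=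
  (h' x + b x - mean mu (cell s) (fun y => h y + b y)) / eps ^+ 2.

Definition semi_implicit_step (eps dt : R) (h : V -> R) (u : V -> V)
    (h' : V -> R) (u' : V -> V) : Prop :=
  forall x, region s x ->
    (h' x - h x) / dt + div (discharge h u) x - dt * ddiv (flux h u) x
      - dt * div (fun y => h y *: grad (H2 eps h h') y) x = 0 /\
    dt^-1 *: (discharge h' u' x - discharge h u x) + div_mx (flux h u) x
      + h x *: grad (H2 eps h h') x = 0.

End Scheme.

Section Expansion.
Context {R : realType} {d : nat}.
Notation V := 'rV[R]_d.

Definition C2_le (D : set V) (f : V -> R) (c : R) : Prop :=
  forall x, D x ->
    [/\ `|f x| <= c, forall i, `|pd i f x| <= c
      & forall i j, `|pd i (pd j f) x| <= c].

(* f^eps = a_0 + eps a_1 + eps^2 a_2 + ... as eps -> 0+, in C^2(\bar D) *)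
Definition asymptotic_expansion (D : set V) (f : R -> V -> R)
    (a : nat -> V -> R) : Prop :=
  (forall k, Ck D (closure D) 2 (a k)) /\
  forall N : nat, exists C : R, \forall eps \near 0^'+,
    C2_le D (fun x => f eps x - \sum_(k < N) eps ^+ k * a k x) (C * eps ^+ N).

Definition vector_expansion (D : set V) (f : R -> V -> V)
    (a : nat -> V -> V) : Prop :=
  forall i, asymptotic_expansion D (fun eps x => f eps x 0 i)
                                   (fun k x => a k x 0 i).

End Expansion.

Section Lake.
Context {R : realType} {d : nat}.
Notation V := 'rV[R]_d.

Definition advection (h : V -> R) (u : V -> V) : V -> V :=
  div_mx (fun y => tensor (discharge h u y) (u y)).

(* The lake equations are [lake_op b H0 h u p t x = 0]; p is the field h_2. *)
Definition lake_op (b : V -> R) (H0 : R)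
    (h : R -> V -> R) (u : R -> V -> V) (p : R -> V -> R) (t : R) (x : V)
    : R * R * V :=
  (div (discharge (h t) (u t)) x,
   h t x + b x - H0,
   'D_1 (fun r : R => discharge (h r) (u r) x) t + advection (h t) (u t) x
     + h t x *: grad (p t) x).

(* One step of the time discretization of the lake equations, from (h, u) to
   (h', u', p'). *)
Definition lake_step_op (b : V -> R) (H0 dt : R)
    (h : V -> R) (u : V -> V) (h' : V -> R) (u' : V -> V) (p' : V -> R) (x : V)
    : R * R * V :=
  (div (discharge h' u') x,
   h' x + b x - H0,
   dt^-1 *: (discharge h' u' x - discharge h u x) + advection h u x
     + h x *: grad p' x).

(* Consistency in the sense that P_{dt} w - P w -> 0 as dt -> 0, uniformly,
   for all fields w = (h, u, p) of class C^1 and not only for the solutions of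
   P w = 0. *)
Definition consistent (s : setting R d)
    (step : R -> (V -> R) -> (V -> V) -> (V -> R) -> (V -> V) -> (V -> R) ->
            V -> R * R * V)
    (op : (R -> V -> R) -> (R -> V -> V) -> (R -> V -> R) -> R -> V ->
          R * R * V) : Prop :=
  forall (T : R) (h : R -> V -> R) (u : R -> V -> V) (p : R -> V -> R),
    let Q : set (R * V) := [set z | 0 < z.1 < T /\ region s z.2] in
    0 < T ->
    Ck Q (closure Q) 1 (fun z : R * V => h z.1 z.2) ->
    Ck Q (closure Q) 1 (fun z : R * V => u z.1 z.2) ->
    Ck Q (closure Q) 1 (fun z : R * V => p z.1 z.2) ->
    (forall t, 0 <= t <= T ->
       boundary_condition s (h t) (u t) /\ field_on s (p t)) ->
    forall eta : R, 0 < eta -> \forall dt \near 0^'+,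
      forall t x, 0 < t -> t + dt < T -> region s x ->
        `|step dt (h t) (u t) (h (t + dt)) (u (t + dt)) (p (t + dt)) x
          - op h u p t x| < eta.

End Lake.

(* Main.v *)
Require Import Defs.
From mathcomp Require Import all_boot all_order all_algebra.
From mathcomp Require Import all_classical all_reals all_analysis.
From mathcomp Require Import ring lra.

Set Implicit Arguments.
Unset Strict Implicit.
Unset Printing Implicit Defensive.

Import Order.TTheory GRing.Theory Num.Theory.
Import numFieldNormedType.Exports.

Local Open Scope classical_set_scope.
Local Open Scope ring_scope.

(* At the orders eps^-2 and eps^-1 the momentum equation forces
   grad (h_0^{n+1} + b) = 0 and grad h_1^{n+1} = 0; at order 1 it is the
   momentum equation of the lake step. Substituting its divergence in the mass
   equation gives (h^{n+1} - h^n) / dt + div (h u)^{n+1} = 0, exactly in eps.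
   Hence div (h_0 u_0)^{n+1} is constant in space if the level at time n is
   constant, and the boundary condition makes this constant vanish by the
   divergence theorem, so that the two levels agree.

   The divergence theorem is proved with averages over grids of a box instead of
   integrals: their invariance under the shift by one cell is the integration by
   parts. Near a boundary point with a normal the field is cut off along the
   levels of a defining function phi, with an error controlled by the average of
   the slab |phi| <= delta and by the smallness of the normal component; the
   boundary points without normal are cut off by bumps on a small cover.

   Consistency follows from the mean value theorem in time and the uniform
   continuity of the fields and of their derivatives on compact sets. *)

(** Only the vanishing of the constant divergence c is needed, so no surface integral has to be
    defined: a weak form tested with cutoffs suffices. In it c is multiplied by a volume bounded
    below, and all other terms must be made small. A cutoff at depth delta has a gradient of order 1
    / delta on a slab of volume of order delta, so its contribution is of order 1 and does not
    vanish with delta by itself. It is saved by the normal component of the field, which tends to 0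
    at the boundary. At corners and edges there is no normal, but cutting off a ball of radius r
    costs only (1 / r) r ^ d, and [surface_null] makes the sum of r ^ (d - 1) over a cover
    arbitrarily small. Grid averages are enough because the argument uses only linearity,
    positivity, shifts and crude volume bounds for cubes and slabs. The momentum equation makes each
    level after a step constant, with a constant that might change with n; the divergence argument
    excludes this change. *)

Local Notation unitv i := (delta_mx 0 i).

(** * Averages over grids *)

Section GridAverage.
Context {R : realType} {d : nat}.
Notation V := 'rV[R]_d.
Variables (a L : V).
Implicit Types (f g : V -> R) (i : 'I_d) (N : nat).

Definition gridpt N (k : {ffun 'I_d -> 'I_N.+1}) : V :=
  \row_i (a 0 i + (k i)%:R / N.+1%:R * L 0 i).

Definition avg N f : R := (\sum_(k : {ffun 'I_d -> 'I_N.+1}) f (gridpt k)) / N.+1%:R ^+ d.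

Lemma avgD N f g : avg N (fun x => f x + g x) = avg N f + avg N g.
Proof. by rewrite /avg big_split /= mulrDl. Qed.

Lemma avgZ N (c : R) f : avg N (fun x => c * f x) = c * avg N f.
Proof. by rewrite /avg -mulr_sumr mulrA. Qed.

Lemma avgB N f g : avg N (fun x => f x - g x) = avg N f - avg N g.
Proof. by rewrite /avg sumrB mulrBl. Qed.

Lemma avg_sum N (I : Type) (r : seq I) (F : I -> V -> R) :
  avg N (fun x => \sum_(j <- r) F j x) = \sum_(j <- r) avg N (F j).
Proof. by rewrite /avg exchange_big /= mulr_suml. Qed.

Lemma eq_avg N f g : f =1 g -> avg N f = avg N g.
Proof. by move=> fg; rewrite /avg; congr (_ / _); apply: eq_bigr. Qed.

Definition in_box (x : V) := forall i, a 0 i <= x 0 i <= a 0 i + L 0 i.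

Definition in_obox (x : V) := forall i, a 0 i < x 0 i < a 0 i + L 0 i.

Hypothesis L_gt0 : forall i, 0 < L 0 i.

Lemma gridpt_in_box N (k : {ffun 'I_d -> 'I_N.+1}) : in_box (gridpt k).
Proof.
move=> i; rewrite mxE lerDl mulr_ge0 ?(ltW (L_gt0 _)) ?divr_ge0 //=.
rewrite lerD2l ler_piMl ?(ltW (L_gt0 _)) // ler_pdivrMr ?ltr0n // mul1r ler_nat.
exact: ltnW.
Qed.

Lemma ler_avg N f g : (forall x, in_box x -> f x <= g x) -> avg N f <= avg N g.
Proof.
move=> fg; rewrite /avg ler_wpM2r ?invr_ge0 ?exprn_ge0 //.
by apply: ler_sum => k _; apply: fg; exact: gridpt_in_box.
Qed.

Lemma avg_cst N (c : R) : avg N (fun=> c) = c.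
Proof.
rewrite /avg sumr_const card_ffun !card_ord -(mulr_natl c) natrX mulrAC.
by rewrite mulfV ?mul1r // expf_neq0 // pnatr_eq0.
Qed.

Lemma ler_norm_avg N f : `|avg N f| <= avg N (fun x => `|f x|).
Proof.
rewrite /avg normrM (@ger0_norm _ (_^-1)) ?invr_ge0 ?exprn_ge0 //.
by rewrite ler_wpM2r ?invr_ge0 ?exprn_ge0 // ler_norm_sum.
Qed.

(** Agreement on opposite faces covers both uses: periodic fields on a period box, and functions
    that vanish on the faces of a box around the domain. *)
Definition face_match i f :=
  forall x, in_box x -> x 0 i = a 0 i -> f (x + L 0 i *: unitv i) = f x.

(* The shift by one grid cell acts on the indices as a cyclic permutation; the
   values at the two opposite faces are the same by [face_match]. *)
Lemma avg_shift N i f : face_match i f ->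
  avg N (fun x => f (x + (L 0 i / N.+1%:R) *: unitv i)) = avg N f.
Proof.
move=> fm; rewrite /avg; congr (_ / _).
pose sh (e : 'I_N.+1 -> 'I_N.+1) (k : {ffun 'I_d -> 'I_N.+1}) :=
  [ffun j => if j == i then e (k j) else k j].
rewrite [RHS](reindex (sh (@ordS N.+1))); last first.
  exists (sh (@ord_pred N.+1)) => k _; apply/ffunP => j; rewrite !ffunE.
    by case: eqP => // _; rewrite ordSK.
  by case: eqP => // _; rewrite ord_predK.
apply: eq_bigr => k _.
have [kN|kN] := ltnP (k i).+1 N.+1.
  congr f; apply/rowP => j; rewrite !mxE ffunE eqxx /=.
  have [->|ji] := eqVneq j i; last by rewrite mulr0 addr0.
  rewrite /= modn_small // mulr1 -addrA; congr (_ + _).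
  by rewrite [(nat_of_ord _).+1%:R]mulrSr mulrDl mulrDl mul1r [_^-1 * _]mulrC.
have kiN : k i = N :> nat.
  by apply/eqP; rewrite eqn_leq -ltnS ltn_ord -ltnS.
rewrite -[RHS]fm.
- congr f; apply/rowP => j; rewrite !mxE ffunE eqxx /=.
  have [->|ji] := eqVneq j i; last by rewrite !mulr0 !addr0.
  rewrite /= kiN modnn mul0r mul0r addr0 !mulr1 -addrA; congr (_ + _).
  rewrite [_ / _ * _]mulrAC -mulrDl -[X in _ + X]mul1r -mulrDl -mulrSr mulrAC.
  by rewrite mulfV ?mul1r // pnatr_eq0.
- exact: gridpt_in_box.
- by rewrite mxE ffunE eqxx /= kiN modnn mul0r mul0r addr0.
Qed.

End GridAverage.

(** * Derivatives, cutoff functions and bumps *)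

Section LineDerivatives.
Context {R : realType}.

Lemma is_derive_line (W X : normedModType R) (f : W -> X) (x v : W) (t : R) df :
  is_derive (x + t *: v) v f df -> is_derive t 1 (fun s : R => f (x + s *: v)) df.
Proof.
move=> [fd fe].
have E : (fun h : R => h^-1 *: (f (x + (h *: (1 : R) + t) *: v) - f (x + t *: v)))
    = (fun h : R => h^-1 *: (f (h *: v + (x + t *: v)) - f (x + t *: v))).
  apply/funext => h; congr (_ *: (f _ - _)).
  by rewrite [h *: 1]mulr1 scalerDl addrCA.
apply: DeriveDef; first by rewrite /derivable /= E.
by rewrite /derive /= E.
Qed.

Lemma mvt_line (W : normedModType R) (f df : W -> R) (x v : W) (t : R) :
  0 <= t -> (forall s, 0 <= s <= t -> is_derive (x + s *: v) v f (df (x + s *: v))) ->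
  exists2 s, 0 <= s <= t & f (x + t *: v) - f x = t * df (x + s *: v).
Proof.
move=> t0 fd.
have D s : s \in `[0, t]%R ->
    is_derive s 1 (fun s : R => f (x + s *: v)) (df (x + s *: v)).
  by rewrite in_itv /= => st; apply: is_derive_line; exact: fd.
have cf : {within `[0, t], continuous (fun s : R => f (x + s *: v))}.
  apply: derivable_within_continuous => s /D ds.
  exact: (@ex_derive _ _ _ _ _ _ _ ds).
have D' s : s \in `]0, t[%R ->
    is_derive s 1 (fun s : R => f (x + s *: v)) (df (x + s *: v)).
  by move=> /subset_itv_oo_cc; exact: D.
have [s] := MVT_segment t0 D' cf.
by rewrite in_itv /= => st; rewrite scale0r addr0 subr0 mulrC; exists s.
Qed.

(** Here f has only a directional derivative, so the chain rule is applied to its restriction to the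
    line through x, a function of one real variable. *)
Lemma is_derive_comp1 (W : normedModType R) (f : W -> R) (g : R -> R)
    (x v : W) (df dg : R) :
  is_derive x v f df -> is_derive (f x) 1 g dg ->
  is_derive x v (fun y => g (f y)) (dg * df).
Proof.
move=> Df Dg.
have D0 : is_derive (0 : R) 1 (fun s : R => f (x + s *: v)) df.
  by apply: is_derive_line; rewrite scale0r addr0.
have Dg0 : is_derive (f (x + (0 : R) *: v)) 1 g dg by rewrite scale0r addr0.
have [D1 D2] := is_derive1_comp Dg0 D0.
have E : (fun h : R => h^-1 *: (g (f (h *: v + x)) - g (f x))) =
    (fun h : R => h^-1 *: (((fun u => g u) \o (fun s : R => f (x + s *: v)))
       (h *: (1 : R) + 0) - ((fun u => g u) \o (fun s : R => f (x + s *: v))) 0)).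
  apply/funext => h /=; rewrite addr0 [h *: 1]mulr1 scale0r addr0.
  by rewrite [h *: v + x]addrC.
apply: DeriveDef; first by rewrite /derivable /= E.
by rewrite /derive /= E -D2.
Qed.

End LineDerivatives.

Section SmoothStep.
Context {R : realType}.
Implicit Types s h : R.

(** A quadratic Taylor remainder treats the knots of a spline like all other points, without
    one-sided derivatives. *)
Lemma is_derive_quadratic (f : R -> R) (x df C : R) :
  (forall h, `|f (h + x) - f x - h * df| <= C * h ^+ 2) -> is_derive x 1 f df.
Proof.
move=> H.
have cv : (h^-1 *: (f (h *: (1 : R) + x) - f x)) @[h --> 0^'] --> df.
  apply/cvgrPdist_le => e e0; near=> h.
  have h0 : h != 0 by near: h; exact: nbhs_dnbhs_neq.
  rewrite [h *: 1]mulr1 /=.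
  have -> : df - h^-1 *: (f (h + x) - f x) = - (h^-1 * (f (h + x) - f x - h * df)).
    by rewrite mulrBr mulKf // opprB.
  rewrite normrN normrM (le_trans (ler_wpM2l _ (H h))) // normfV.
  rewrite -(real_normK (num_real h)) expr2 mulrCA mulKf ?normr_eq0 //.
  have : `|h| <= e / (`|C| + 1).
    by near: h; apply: dnbhs0_le; rewrite divr_gt0 // ltr_wpDl.
  rewrite ler_pdivlMr ?ltr_wpDl // => he.
  apply: le_trans he; rewrite mulrC ler_wpM2l //.
  by rewrite (le_trans (ler_norm _)) // lerDl.
by apply: DeriveDef; [apply/cvg_ex; exists df | apply/cvg_lim].
Unshelve. all: by end_near. Qed.

Definition pospart s : R := Num.max 0 s.

(* The derivative is the hat function 4 s on [0, 1/2], 4 (1 - s) on [1/2, 1]. *)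
Definition smoothstep s : R :=
  2 * pospart s ^+ 2 - 4 * pospart (s - 1/2) ^+ 2 + 2 * pospart (s - 1) ^+ 2.

Definition dsmoothstep s : R :=
  4 * pospart s - 8 * pospart (s - 1/2) + 4 * pospart (s - 1).

Lemma pospartP s : (0 <= s /\ pospart s = s) \/ (s <= 0 /\ pospart s = 0).
Proof. by rewrite /pospart; case: (leP 0 s) => H; [left|right]; split=> //; exact: ltW. Qed.
Lemma pospart_sqr_approx s h :
  `|pospart (h + s) ^+ 2 - pospart s ^+ 2 - h * (2 * pospart s)| <= h ^+ 2.
Proof.
rewrite ler_norml !expr2; have h2 := sqr_ge0 h; rewrite expr2 in h2.
have [[hs ->]|[hs ->]] := pospartP (h + s); have [[s0 ->]|[s0 ->]] := pospartP s.
- by apply/andP; split; lra.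
- have := mulr_ge0 hs hs; have : 0 <= (h + s) * - s by rewrite mulr_ge0 ?oppr_ge0.
  have : 0 <= - s * - s by rewrite mulr_ge0 ?oppr_ge0.
  by move=> ? ? ?; apply/andP; split; lra.
- have : 0 <= - (h + s) * s by rewrite mulr_ge0 ?oppr_ge0.
  have := mulr_ge0 s0 s0; have : 0 <= - (h + s) * - (h + s) by rewrite mulr_ge0 ?oppr_ge0.
  by move=> ? ? ?; apply/andP; split; lra.
- by apply/andP; split; lra.
Qed.
Lemma is_derive_smoothstep s : is_derive s 1 smoothstep (dsmoothstep s).
Proof.
(* 8 = 2 + 4 + 2, the sum of the absolute values of the coefficients of [smoothstep]. *)
apply: (@is_derive_quadratic _ _ _ 8) => h.
have := pospart_sqr_approx s h.
have := pospart_sqr_approx (s - 1/2) h.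
have := pospart_sqr_approx (s - 1) h.
rewrite /smoothstep /dsmoothstep !addrA !ler_norml => /andP[? ?] /andP[? ?] /andP[? ?].
by apply/andP; split; lra.
Qed.

Lemma pospart_continuous : continuous pospart.
Proof.
move=> s; apply/cvgrPdist_lt => e e0; near=> t.
have : `|s - t| < e by near: t; apply/nbhs_ballP; exists e.
apply: le_lt_trans.
have := ler_norm (s - t); have := ler_norm (- (s - t)).
rewrite normrN ler_norml; move=> ? ?.
by case: (pospartP s) => -[? ->]; case: (pospartP t) => -[? ->]; apply/andP; split; lra.
Unshelve. all: by end_near. Qed.

Lemma dsmoothstep_continuous : continuous dsmoothstep.
Proof.
move=> s; rewrite /dsmoothstep.
have P (c : R) : {for s, continuous (fun t : R => pospart (t - c))}.
  apply: (@continuous_comp _ _ _ (fun t : R => t - c) pospart).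
    by apply: cvgB; [exact: cvg_id | exact: cvg_cst].
  exact: pospart_continuous.
apply: cvgD; first apply: cvgB.
- by apply: cvgMr; exact: pospart_continuous.
- by apply: cvgMr; exact: P.
- by apply: cvgMr; exact: P.
Qed.

Local Ltac pos_cases s := 
 have [[? ->]|[? ->]] := pospartP s;
 have [[? ->]|[? ->]] := pospartP (s - 1/2);
 have [[? ->]|[? ->]] := pospartP (s - 1); rewrite ?expr0n /= ?expr2.
Lemma smoothstep_itv s : 0 <= smoothstep s <= 1.
Proof. rewrite /smoothstep; pos_cases s; apply/andP; split; nra. Qed.

Lemma smoothstep0 s : s <= 0 -> smoothstep s = 0.
Proof. rewrite /smoothstep; pos_cases s => ?; first [nra | lra]. Qed.

Lemma smoothstep1 s : 1 <= s -> smoothstep s = 1.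
Proof.  rewrite /smoothstep; pos_cases s => ?; first [nra | lra]. Qed.

Lemma dsmoothstep_itv s : 0 <= dsmoothstep s <= 2.
Proof. rewrite /dsmoothstep; pos_cases s; lra. Qed.

Lemma dsmoothstep_eq0 s : s <= 0 \/ 1 <= s -> dsmoothstep s = 0.
Proof. rewrite /dsmoothstep; pos_cases s => -[] ?; lra. Qed.

End SmoothStep.

(** * Uniformity on compact sets and local continuity *)

Section CompactUniformity.

(** Each point has a ball on which the property holds for all late i, and finitely many balls cover
    K. The filter is arbitrary because the lemma serves N -> oo as well as delta -> 0+ and dt ->
    0+. *)
Lemma compact_near_uniform (R : realType) (W : pseudoMetricType R) (K : set W)
    (I : Type) (F : set_system I) (P : I -> W -> Prop) :
  Filter F -> compact K ->
  (forall x, K x -> exists2 r : R, 0 < r &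
     \forall i \near F, forall y, ball x r y -> K y -> P i y) ->
  \forall i \near F, forall y, K y -> P i y.
Proof.
move=> FF /compact_near_coveringP/near_covering_withinP KP H.
have := KP I F P FF; apply => x Kx.
have [r r0 Hr] := H x Kx.
exists (ball x r, [set i | forall y, ball x r y -> K y -> P i y]) => /=.
  by split=> //; exact: nbhsx_ballx.
by move=> [y i] /= [xy]; exact.
Qed.

Lemma continuous_near_eq (S T : topologicalType) (f g : S -> T) (x : S) :
  {near x, f =1 g} -> {for x, continuous f} -> {for x, continuous g}.
Proof.
move=> fg cf; rewrite /prop_for /continuous_at -(nbhs_singleton fg).
by apply: cvg_trans cf; apply: near_eq_cvg; move: fg; apply: filterS.
Qed.

Lemma within_continuous_at (S T : topologicalType) (K : set S) (f : S -> T)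
    (x : S) :
  {within K, continuous f} -> nbhs x K -> {for x, continuous f}.
Proof.
move=> /subspace_continuousP cf Kx A fA.
have := cf x (nbhs_singleton Kx) A fA; rewrite nbhs_simpl /within /=.
by apply: filterS2 Kx => y Ky; exact.
Qed.

End CompactUniformity.

Section RealContinuity.
Context {R : realType} {T : topologicalType}.
Implicit Types (f g : T -> R) (x : T).

Lemma continuous_at_cst (c : R) x : {for x, continuous (fun=> c)}.
Proof. by rewrite /prop_for /continuous_at; exact: cvg_cst. Qed.

Lemma continuous_atD f g x : {for x, continuous f} -> {for x, continuous g} ->
  {for x, continuous (fun y => f y + g y)}.
Proof. by rewrite /prop_for /continuous_at => cf cg; exact: cvgD. Qed.

Lemma continuous_atB f g x : {for x, continuous f} -> {for x, continuous g} ->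
  {for x, continuous (fun y => f y - g y)}.
Proof. by rewrite /prop_for /continuous_at => cf cg; exact: cvgB. Qed.

Lemma continuous_atM f g x : {for x, continuous f} -> {for x, continuous g} ->
  {for x, continuous (fun y => f y * g y)}.
Proof. by rewrite /prop_for /continuous_at => cf cg; exact: cvgM. Qed.

End RealContinuity.

Section C1Functions.
Context {R : realType} {d : nat}.
Notation V := 'rV[R]_d.
Implicit Types (D : set V) (f g : V -> R) (i : 'I_d).

Lemma ballP (x y : V) (r : R) :
  0 < r -> ball x r y <-> forall i, `|x 0 i - y 0 i| < r.
Proof.
move=> r0; split=> [[_ xy] i|xy]; first exact: xy.
by split=> // i j; rewrite (ord1 i); exact: xy.
Qed.

Definition cube (x : V) (r : R) : set V :=
  [set y | forall i, `|y 0 i - x 0 i| <= r].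

Lemma unitvE i j : (unitv i : V) 0 j = (j == i)%:R.
Proof. by rewrite mxE eqxx. Qed.

Lemma compact_box (a b : V) : compact [set x : V | forall i, a 0 i <= x 0 i <= b 0 i].
Proof.
have := @rV_compact R d (fun i => `[a 0 i, b 0 i]%classic).
have -> : [set v : V | forall i, `[a 0 i, b 0 i]%classic (v ord0 i)] =
    [set x : V | forall i, a 0 i <= x 0 i <= b 0 i].
  by apply/seteqP; split=> x /= H i; have := H i; rewrite /= in_itv.
by apply=> i; exact: segment_compact.
Qed.

Lemma compact_cube x r : compact (cube x r).
Proof.
have -> : cube x r =
    [set y : V | forall i, (\row_i (x 0 i - r) : V) 0 i <= y 0 i <= (\row_i (x 0 i + r) : V) 0 i].
  apply/seteqP; split=> y /= H i; have := H i; rewrite !mxE ler_norml.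
    by move=> /andP[? ?]; apply/andP; split; lra.
  by move=> /andP[? ?]; apply/andP; split; lra.
exact: compact_box.
Qed.

(** The part of [Ck] that integration by parts uses: coordinate directions only, and no extension to
    the closure. The condition is pointwise, so it can be localized with D a single point. *)
Definition C1on D f := forall x, D x -> {for x, continuous f} /\
  forall i, derivable f x (unitv i) /\ {for x, continuous (pd i f)}.

Lemma C1on_derive D f x i : C1on D f -> D x -> is_derive x (unitv i) f (pd i f x).
Proof. by move=> fD Dx; apply: derivableP; exact: ((fD x Dx).2 i).1. Qed.

Lemma C1on_sub D D' f : D' `<=` D -> C1on D f -> C1on D' f.
Proof. by move=> DD fD x /DD; exact: fD. Qed.

(** Continuity of [pd i f] at x depends on its values near x, and these are known to be [df i] only
    on D; hence D is open. *)
Lemma C1on_intro D f (df : 'I_d -> V -> R) : open D ->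
  (forall x, D x -> {for x, continuous f} /\
     forall i, is_derive x (unitv i) f (df i x) /\ {for x, continuous (df i)}) ->
  C1on D f /\ forall x, D x -> forall i, pd i f x = df i x.
Proof.
move=> oD H.
have E x (Dx : D x) i : pd i f x = df i x.
  by have [_ /(_ i)[[_ <-] _]] := H x Dx.
split=> // x Dx; have [cf Hf] := H x Dx; split=> // i.
have [[fd _] cdf] := Hf i; split=> //.
apply: continuous_near_eq cdf.
by have := open_nbhs_nbhs (conj oD Dx); apply: filterS => y Dy /=; rewrite E.
Qed.

Lemma pd_near f g x i : {near x, f =1 g} -> pd i f x = pd i g x.
Proof. exact: near_eq_derive. Qed.

Lemma C1on_eq D f g : open D -> {in D, f =1 g} -> C1on D f -> C1on D g.
Proof.
move=> oD fg fD; have nD x (Dx : D x) : {near x, f =1 g}.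
  have := open_nbhs_nbhs (conj oD Dx); apply: filterS => y Dy.
  by apply: fg; rewrite inE.
apply: (proj1 (@C1on_intro D g (fun i => pd i f) oD _)) => x Dx.
split; first exact: continuous_near_eq (nD x Dx) (fD x Dx).1.
move=> i; split; last exact: ((fD x Dx).2 i).2.
by apply: (near_eq_is_derive (nD x Dx)); exact: C1on_derive fD Dx.
Qed.

Lemma pd_cst (c : R) x i : pd i (fun=> c) x = 0.
Proof. exact: derive_cst. Qed.

Lemma C1on_cst D (c : R) : C1on D (fun=> c).
Proof.
move=> x _; split; first exact: continuous_at_cst.
move=> i; split; first exact: derivable_cst.
have -> : pd i (fun _ : V => c) = cst 0 by apply/funext => y; exact: pd_cst.
exact: continuous_at_cst.
Qed.

Lemma pdM f g x i : derivable f x (unitv i) -> derivable g x (unitv i) ->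
  pd i (fun y => f y * g y) x = f x * pd i g x + g x * pd i f x.
Proof. by move=> fx gx; exact: deriveM. Qed.

Lemma pdD f g x i : derivable f x (unitv i) -> derivable g x (unitv i) ->
  pd i (fun y => f y + g y) x = pd i f x + pd i g x.
Proof. by move=> fx gx; exact: deriveD. Qed.

Lemma pdB f g x i : derivable f x (unitv i) -> derivable g x (unitv i) ->
  pd i (fun y => f y - g y) x = pd i f x - pd i g x.
Proof. by move=> fx gx; exact: deriveB. Qed.

Lemma pdZ c f x i : derivable f x (unitv i) ->
  pd i (fun y => c * f y) x = c * pd i f x.
Proof. by move=> fx; exact: deriveZ. Qed.

Lemma derivable_mul f g x i : derivable f x (unitv i) ->
  derivable g x (unitv i) -> derivable (fun y => f y * g y) x (unitv i).
Proof. exact: (@derivableM R V f g x (unitv i)). Qed.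

Lemma derivable_sub f g x i : derivable f x (unitv i) ->
  derivable g x (unitv i) -> derivable (fun y => f y - g y) x (unitv i).
Proof. by move=> fx gx; exact: (derivableB fx gx). Qed.

Lemma C1onM D f g : open D -> C1on D f -> C1on D g ->
  C1on D (fun x => f x * g x).
Proof.
move=> oD fD gD.
apply: (proj1 (@C1on_intro D _ (fun i x => f x * pd i g x + g x * pd i f x) oD _)).
move=> x Dx; have [cf Hf] := fD x Dx; have [cg Hg] := gD x Dx.
split; first exact: (continuous_atM cf cg).
move=> i; have [df cdf] := Hf i; have [dg cdg] := Hg i; split.
  by apply: DeriveDef; [exact: (derivable_mul df dg) | exact: (pdM df dg)].
exact: (continuous_atD (continuous_atM cf cdg) (continuous_atM cg cdf)).
Qed.

Lemma C1onB D f g : open D -> C1on D f -> C1on D g ->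
  C1on D (fun x => f x - g x).
Proof.
move=> oD fD gD.
apply: (proj1 (@C1on_intro D _ (fun i x => pd i f x - pd i g x) oD _)).
move=> x Dx; have [cf Hf] := fD x Dx; have [cg Hg] := gD x Dx.
split; first exact: (continuous_atB cf cg).
move=> i; have [df cdf] := Hf i; have [dg cdg] := Hg i; split.
  by apply: DeriveDef; [exact: (derivable_sub df dg) | exact: (pdB df dg)].
exact: (continuous_atB cdf cdg).
Qed.

Lemma C1on_comp D f (g dg : R -> R) : open D -> C1on D f ->
  (forall s : R, is_derive s 1 g (dg s)) -> continuous dg ->
  C1on D (fun x => g (f x)) /\
  forall x, D x -> forall i, pd i (fun x => g (f x)) x = dg (f x) * pd i f x.
Proof.
move=> oD fD gd cdg; apply: C1on_intro => // x Dx; have [cf Hf] := fD x Dx.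
split.
  apply: (continuous_comp cf).
  by apply/differentiable_continuous/derivable1_diffP; exact: (@ex_derive _ _ _ _ _ _ _ (gd _)).
move=> i; have [df cdf] := Hf i; split.
  exact: (is_derive_comp1 (derivableP df) (gd _)).
exact: (continuous_atM (continuous_comp cf (cdg _)) cdf).
Qed.

Lemma is_derive_coord (x : V) i j : is_derive x (unitv i) (fun y : V => y 0 j) (j == i)%:R.
Proof.
have D : derivable (id : V -> V) x (unitv i) by exact: derivable_id.
apply: DeriveDef; first exact: (derivable_mxP id x (unitv i)).1 D 0 j.
have := derive_mx D; rewrite derive_id => /matrixP /(_ 0 j).
by rewrite !mxE eqxx.
Qed.

Lemma C1on_affine D j (c e : R) :
  open D -> C1on D (fun y => c + e * y 0 j) /\
  forall x, D x -> forall i, pd i (fun y : V => c + e * y 0 j) x = e * (j == i)%:R.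
Proof.
move=> oD; apply: C1on_intro => // x Dx; split.
  apply: (@continuous_atD R V (fun=> c) (fun y : V => e * y 0 j) x); first exact: continuous_at_cst.
  apply: (@continuous_atM R V (fun=> e) (fun y : V => y 0 j) x); first exact: continuous_at_cst.
  exact: coord_continuous.
move=> i; split; last exact: continuous_at_cst.
have H := is_derive_coord x i j.
rewrite -[e * _]add0r; apply: is_deriveD; exact: is_deriveZ.
Qed.

Lemma C1on_continuous f : C1on setT f -> continuous f.
Proof. by move=> fD x; exact: (fD x I).1. Qed.

(** For factors in [0, 1] the derivative of a product and its defect from 1 are at most the sums
    over the factors. The first bound gives the gradient of [bump]; both are used for the cutoff of
    the exceptional boundary points. *)
Lemma C1on_prod D (J : Type) (r : seq J) (f : J -> V -> R) : open D ->
  (forall j, C1on D (f j)) -> (forall j x, 0 <= f j x <= 1) ->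
  [/\ C1on D (fun x => \prod_(j <- r) f j x),
      forall x, 0 <= \prod_(j <- r) f j x <= 1,
      forall x, D x -> forall i, `|pd i (fun x => \prod_(j <- r) f j x) x|
                                 <= \sum_(j <- r) `|pd i (f j) x|
    & forall x, 1 - \prod_(j <- r) f j x <= \sum_(j <- r) (1 - f j x)].
Proof.
move=> oD fD f01; elim: r => [|j r [C P G S]].
  have -> : (fun x : V => \prod_(j <- [::]) f j x) = (fun=> 1).
    by apply/funext => x; rewrite big_nil.
  split=> [|x|x Dx i|x]; first exact: C1on_cst.
  - by rewrite big_nil ler01 lexx.
  - by rewrite big_nil pd_cst normr0.
  - by rewrite !big_nil subrr.
have -> : (fun x : V => \prod_(j <- j :: r) f j x)
    = (fun x => f j x * \prod_(j <- r) f j x).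
  by apply/funext => x; rewrite big_cons.
split=> [|x|x Dx i|x]; first exact: (C1onM oD (fD j) C).
- rewrite big_cons; have /andP[? ?] := f01 j x; have /andP[? ?] := P x.
  by rewrite mulr_ge0 //= mulr_ile1.
- rewrite big_cons pdM; [|exact: ((fD j x Dx).2 i).1|exact: ((C x Dx).2 i).1].
  rewrite addrC (le_trans (ler_normD _ _)) // lerD //.
    rewrite normrM ler_piMl //; have /andP[? ?] := P x.
    by rewrite ger0_norm.
  rewrite normrM (le_trans _ (G x Dx i)) // ler_piMl //.
  by have /andP[? ?] := f01 j x; rewrite ger0_norm.
- rewrite !big_cons; have /andP[? ?] := f01 j x; have /andP[? ?] := P x.
  have := S x; nra.
Qed.

(** Two steps per coordinate, one for each sign, with argument 2 + (x_i - y_i) / r or 2 - (x_i -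
    y_i) / r: both are at least 1 within distance r, and one is at most 0 from distance 2 r on. The
    argument is written as c + e * x_i to fit [C1on_affine]. *)
Definition bump (y : V) (r : R) (x : V) : R :=
  \prod_(p <- enum {: 'I_d * bool})
    smoothstep (2 - (-1) ^+ p.2 * y 0 p.1 / r + (-1) ^+ p.2 / r * x 0 p.1).

Lemma bump_arg (y : V) (r : R) (x : V) i (e : bool) : 0 < r ->
  2 - (-1) ^+ e * y 0 i / r + (-1) ^+ e / r * x 0 i
  = 2 + (-1) ^+ e * ((x 0 i - y 0 i) / r).
Proof. by move=> r0; field; rewrite gt_eqF. Qed.

Lemma bump_C1 (y : V) (r : R) : 0 < r -> C1on setT (bump y r) /\
  forall x i, `|pd i (bump y r) x| <= 4 * d%:R / r.
Proof.
move=> r0; have oT : open [set: V] by exact: openT.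
pose f (p : 'I_d * bool) (x : V) : R :=
  2 - (-1) ^+ p.2 * y 0 p.1 / r + (-1) ^+ p.2 / r * x 0 p.1.
have H (p : 'I_d * bool) := C1on_affine p.1 (2 - (-1) ^+ p.2 * y 0 p.1 / r) ((-1) ^+ p.2 / r) oT.
have S p := C1on_comp oT (H p).1 (@is_derive_smoothstep R) (@dsmoothstep_continuous R).
have [C P G _] := @C1on_prod setT _ (enum {: 'I_d * bool})
  (fun p x => smoothstep (f p x)) oT (fun p => (S p).1) (fun p x => smoothstep_itv _).
split=> // x i; apply: le_trans (G x I i) _.
(* There are 2 d factors, each with a derivative of at most 2 times the slope 1 / r. *)
have -> : 4 * d%:R / r = \sum_(p <- enum {: 'I_d * bool}) (2 / r).
  rewrite big_const_seq count_predT -cardE card_prod card_ord card_bool iter_addr_0.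
  by rewrite -[RHS]mulr_natl natrM; field; rewrite gt_eqF.
apply: ler_sum => p _; rewrite (S p).2 // (H p).2 // normrM.
apply: ler_pM => //.
  by have /andP[? ?] := dsmoothstep_itv (f p x); rewrite ger0_norm.
rewrite !normrM normrX normrN1 expr1n mul1r.
rewrite [X in _ * X <= _]ger0_norm ?ler0n // gtr0_norm ?invr_gt0 //.
by case: eqP => _; rewrite ?mulr1 ?mulr0 // invr_ge0 ltW.
Qed.

Lemma bump_itv (y : V) (r : R) x : 0 <= bump y r x <= 1.
Proof.
rewrite /bump; elim/big_ind: _; rewrite ?ler01 ?lexx //.
  by move=> u v /andP[? ?] /andP[? ?]; rewrite mulr_ge0 //= mulr_ile1.
by move=> p _; exact: smoothstep_itv.
Qed.

Lemma bump1 (y : V) (r : R) x : 0 < r -> ball y r x -> bump y r x = 1.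
Proof.
move=> r0 /(ballP _ _ r0) yx; rewrite /bump big1 // => p _.
rewrite bump_arg // smoothstep1 //.
have := yx p.1; rewrite distrC ltr_norml -(ltr_pM2r (x := r^-1)) ?invr_gt0 //.
rewrite -[X in _ && X](ltr_pM2r (x := r^-1)) ?invr_gt0 // mulNr divff ?gt_eqF //.
by case: p => j [] /=; rewrite ?expr1 ?expr0 => /andP[? ?]; lra.
Qed.

Lemma bump0 (y : V) (r : R) x : 0 < r -> ~ ball y (2 * r) x -> bump y r x = 0.
Proof.
move=> r0 yx; have [i xi] : exists i, 2 * r <= `|y 0 i - x 0 i|.
  apply/not_existsP => H; apply: yx; apply/ballP; first by rewrite mulr_gt0.
  by move=> i; rewrite ltNge; apply/negP; exact: H.
have [e he] : exists e : bool, 2 + (-1) ^+ e * ((x 0 i - y 0 i) / r) <= 0.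
  move: xi; rewrite distrC ler_normr => /orP[] h; [exists true|exists false].
    rewrite expr1 mulN1r subr_le0 ler_pdivlMr //.
  by rewrite expr0 mul1r -[2]opprK addrC subr_le0 ler_pdivrMr // mulNr; lra.
apply/eqP; rewrite prodf_seq_eq0; apply/hasP; exists (i, e).
  by rewrite mem_enum.
by rewrite /= bump_arg // smoothstep0.
Qed.

End C1Functions.

(** * Integration by parts on grids *)

Section GridAverageDerivative.
Context {R : realType} {d : nat}.
Notation V := 'rV[R]_d.
Variables (a L : V).
Hypothesis L_gt0 : forall i, 0 < L 0 i.
Implicit Types (f g : V -> R).

(** The difference quotient whose step is one grid cell has average 0 by [avg_shift]. The mean value
    theorem replaces it by the derivative, with an error controlled by uniform continuity. Shifted
    points may leave the box, hence the regularity on the whole space. *)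
Lemma avg_pd f i : C1on setT f -> face_match a L i f ->
  avg a L N (pd i f) @[N --> \oo] --> 0.
Proof.
move=> fC fm; apply/cvgrPdist_le => /= e e0.
pose h N : R := L 0 i / N.+1%:R.
have h0 N : 0 < h N by rewrite divr_gt0.
have cvh : h N @[N --> \oo] --> 0.
  by rewrite -[0](mulr0 (L 0 i)); apply: cvgMr; exact: cvg_harmonic.
have unif : \forall N \near \oo, forall x, in_box a L x ->
    forall s, 0 <= s <= h N -> `|pd i f (x + s *: unitv i) - pd i f x| <= e.
  have Kc : compact [set x | in_box a L x].
    have -> : [set x | in_box a L x] =
      [set x : V | forall i, a 0 i <= x 0 i <= (a + L) 0 i].
      by apply/seteqP; split=> x H j; have := H j; rewrite mxE.
    exact: compact_box.
  apply: (@compact_near_uniform R V _ nat \oo (fun N x => forall s, 0 <= s <= h N ->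
    `|pd i f (x + s *: unitv i) - pd i f x| <= e) _ Kc) => x _.
  have e2 : 0 < e / 2 by rewrite divr_gt0.
  have [_ /(_ i)[_ /cvgrPdist_lt /(_ (e / 2) e2)]] := fC x I.
  move=> /nbhs_ballP[r /= r0 Hr]; exists (r / 2); first by rewrite divr_gt0.
  have : \forall N \near \oo, h N < r / 2.
    by apply: (cvgr_lt 0) => //; rewrite divr_gt0.
  apply: filterS => N hN y xy _ s /andP[s0 sh].
  have r2 : 0 < r / 2 by rewrite divr_gt0.
  have B1 : ball x r y.
    by apply: le_ball xy; lra.
  have B2 : ball x r (y + s *: unitv i).
    apply/ballP => // j; rewrite mxE mxE unitvE opprD addrA.
    apply: le_lt_trans (ler_normB _ _) _.
    have := (ballP _ _ r2).1 xy j.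
    have : `|s * (j == i)%:R| <= s.
      by case: eqP => _; rewrite ?mulr1 ?mulr0 ?normr0 // ger0_norm.
    by lra.
  have := Hr _ B1; have := Hr _ B2; rewrite /= => P1 P2.
  rewrite -(subrKA (pd i f x)) (le_trans (ler_normD _ _)) // distrC.
  by rewrite [e]splitr lerD // ltW.
move: unif; apply: filterS => N unif; rewrite sub0r normrN.
have -> : avg a L N (pd i f) = (h N)^-1 *
    avg a L N (fun x => h N * pd i f x - (f (x + h N *: unitv i) - f x)).
  rewrite avgB avgB (avg_shift L_gt0 N fm) // subrr subr0 avgZ mulKf //.
  by rewrite gt_eqF.
rewrite normrM gtr0_norm ?invr_gt0 // mulrC ler_pdivrMr //.
apply: le_trans (ler_norm_avg _ _ _ _) _.
rewrite -(avg_cst a L N (e * h N)); apply: (ler_avg L_gt0) => x xB.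
have [s sh ->] := @mvt_line R V f (pd i f) x (unitv i) (h N) (ltW (h0 N))
  (fun s _ => C1on_derive i fC I).
rewrite -mulrBr normrM (gtr0_norm (h0 N)) mulrC ler_wpM2r ?(ltW (h0 N)) //.
by rewrite distrC; exact: unif.
Qed.

(** The extension of g by 0 is C^1 on the whole space, being g near the points of D and 0 near the
    others; it matches on the faces since D lies in the open box. *)
Lemma avg_pd_zero_ext (D : set V) g i : open D -> D `<=` [set x | in_obox a L x] ->
  C1on D g -> (forall y, ~ D y -> \forall x \near y, D x -> g x = 0) ->
  avg a L N (fun x => if x \in D then pd i g x else 0) @[N --> \oo] --> 0.
Proof.
move=> oD DB gC g0.
pose f x := if x \in D then g x else 0.
have near0 y : ~ D y -> \forall x \near y, f x = 0.
  move=> /g0; apply: filterS => x; rewrite /f; case: ifPn => //.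
  by rewrite inE => Dx; exact.
have nearg y : D y -> {near y, g =1 f}.
  move=> Dy; have := open_nbhs_nbhs (conj oD Dy); apply: filterS => x Dx.
  by rewrite /f mem_set.
have [fC pdf] : C1on setT f /\ forall x, setT x -> forall i,
    pd i f x = (if x \in D then pd i g x else 0).
  apply: (@C1on_intro _ _ setT f (fun i x => if x \in D then pd i g x else 0)).
    exact: openT.
  move=> x _; have [Dx|nDx] := pselect (D x).
    split; first exact: continuous_near_eq (nearg x Dx) (gC x Dx).1.
    move=> j; rewrite mem_set //; split.
      by apply: near_eq_is_derive (nearg x Dx) _; exact: C1on_derive gC Dx.
    apply: continuous_near_eq ((gC x Dx).2 j).2.
    have := open_nbhs_nbhs (conj oD Dx); apply: filterS => z Dz.
    by rewrite mem_set.
  have f0 : {near x, (fun=> 0) =1 f} by apply: filterS (near0 x nDx) => z ->.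
  split; first by apply: continuous_near_eq f0 _; exact: continuous_at_cst.
  move=> j; rewrite memNset //; split.
    by apply: near_eq_is_derive f0 _; exact: is_derive_cst.
  apply: (@continuous_near_eq _ _ (fun=> 0)); last exact: continuous_at_cst.
  (* At a point z of D close to x the extension is 0 in a whole neighbourhood of z, so that the
     derivative of g vanishes there too. *)
  have := near_join f0; apply: filterS => z z0; case: ifPn => //; rewrite inE => Dz.
  rewrite -(pd_cst 0 z j) /pd; apply: near_eq_derive.
  have := nearg z Dz; apply: filterS2 z0 => w; by move=> -> ->.
have -> : (fun x => if x \in D then pd i g x else 0) = pd i f.
  by apply/funext => x; rewrite pdf.
apply: avg_pd fC _ => x xB xa.
rewrite /f !memNset //; first by move=> /DB /(_ i); rewrite xa ltxx.
by move=> /DB /(_ i); rewrite mxE mxE unitvE eqxx mulr1 xa ltxx andbF.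
Qed.

End GridAverageDerivative.

(** * Averages of cubes and slabs *)

Section GridCount.
Context {R : realType}.

Lemma count_itv_le (M : nat) (s t : R) : s <= t ->
  \sum_(k < M) (s <= k%:R <= t)%R%:R <= t - s + 1.
Proof.
move=> st.
(* The extra bound carries the induction: if M is counted, the earlier points number at most M - s,
   which is at most t - s. *)
suff [] : \sum_(k < M) (s <= k%:R <= t)%R%:R <= Num.max 0 (M%:R - s) :> R /\
          \sum_(k < M) (s <= k%:R <= t)%R%:R <= t - s + 1 by [].
elim: M => [|M [IH1 IH2]].
  by rewrite !big_ord0 le_max lexx; split=> //; lra.
rewrite !big_ord_recr /=; move: IH1 IH2; set n := \sum_(i < M) _.
rewrite !le_max -natr1; case: (leP s M%:R) => sM; case: (leP M%:R t) => Mt /=;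
  move=> /orP[] h1 h2; split; rewrite ?mulr1n ?mulr0n; try lra;
  apply/orP; by [left; lra|right; lra].
Qed.

Lemma count_itv_ge (M : nat) (s t : R) : 0 <= s -> t <= M%:R ->
  t - s - 1 <= \sum_(k < M) (s <= k%:R <= t)%R%:R.
Proof.
move=> s0 tM.
(* With the minimum the bound holds for every M, so the induction does not need t <= M. *)
suff : Num.min t M%:R - s - 1 <= \sum_(k < M) (s <= k%:R <= t)%R%:R.
  by apply: le_trans; rewrite min_l.
move: {tM} M; elim=> [|M IH].
  rewrite big_ord0; have : Num.min t 0 <= 0 by rewrite ge_min lexx orbT.
  by lra.
rewrite big_ord_recr /=; move: IH; set n := \sum_(i < M) _.
have n0 : 0 <= n by apply: sumr_ge0.
move: (n) n0 => {}n n0; rewrite -natr1.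
case: (leP s M%:R) => sM; case: (leP M%:R t) => Mt /=; rewrite ?mulr1n ?mulr0n.
- have : Num.min t (M%:R + 1) <= M%:R + 1 by rewrite ge_min lexx orbT.
  by move: (Num.min _ _) => P hP hn; lra.
- have tM : t <= M%:R + 1 by lra.
  by rewrite (min_l tM); lra.
- have : Num.min t (M%:R + 1) <= M%:R + 1 by rewrite ge_min lexx orbT.
  by move: (Num.min _ _) => P hP hn; lra.
- have tM : t <= M%:R + 1 by lra.
  by rewrite (min_l tM); lra.
Qed.

Context {d : nat}.
Notation V := 'rV[R]_d.
Variables (a : V) (ell : R).
Hypothesis ell_gt0 : 0 < ell.
Notation L := (const_mx ell : V).

Definition ind (A : set V) (x : V) : R := (x \in A)%:R.

Lemma ind_itv A x : 0 <= ind A x <= 1.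
Proof. by rewrite /ind; case: (_ \in _); rewrite ?ler01 ?lexx. Qed.

Lemma ind1 (A : set V) x : A x -> ind A x = 1.
Proof. by move=> Ax; rewrite /ind mem_set. Qed.

Lemma ind0 (A : set V) x : ~ A x -> ind A x = 0.
Proof. by move=> Ax; rewrite /ind memNset. Qed.

(** Cube and grid are both products, so the average factors into proportions of integers in
    intervals. *)
Lemma avg_cubeE N (y : V) (r : R) : avg a L N (ind (cube y r)) = \prod_i
  ((\sum_(k < N.+1) (N.+1%:R * (y 0 i - a 0 i - r) / ell <= k%:R
      <= N.+1%:R * (y 0 i - a 0 i + r) / ell)%R%:R) / N.+1%:R).
Proof.
rewrite big_split /= big_const_ord iter_mulr_1 exprVn /avg; congr (_ / _).
rewrite (bigA_distr_bigA (fun i (k : 'I_N.+1) =>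
  (N.+1%:R * (y 0 i - a 0 i - r) / ell <= k%:R
      <= N.+1%:R * (y 0 i - a 0 i + r) / ell)%R%:R)) /=.
apply: eq_bigr => k _.
have E i : (`|gridpt a L k 0 i - y 0 i| <= r) =
  (N.+1%:R * (y 0 i - a 0 i - r) / ell <= (k i)%:R
      <= N.+1%:R * (y 0 i - a 0 i + r) / ell).
  rewrite !mxE ler_norml ler_pdivrMr // ler_pdivlMr //.
  rewrite mulrAC; have NR : (0 : R) < N.+1%:R by rewrite ltr0n.
  set u := _ * ell.
  rewrite !(mulrC N.+1%:R) -[X in _ = X && _](ler_pdivlMr _ _ NR).
  rewrite -[X in _ = _ && X](ler_pdivrMr _ _ NR).
  by move: (u / _) => w; apply/idP/idP => /andP[? ?]; apply/andP; split; lra.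
have [ky|nky] := pselect (cube y r (gridpt a L k)).
  by rewrite ind1 // big1 // => i _; rewrite -E; move: (ky i) => /= ->.
rewrite ind0 //; move: nky => /existsNP [i /negP ni].
by rewrite (bigD1 i) //= -E (negbTE ni) mul0r.
Qed.

(** Each coordinate counts at most 2 r (N + 1) / ell + 1 points. Once a cell is smaller than r the
    final 1 is at most r (N + 1) / ell, and the factor 4 covers it. *)
Lemma avg_cube_le (y : V) (r : R) : 0 < r ->
  \forall N \near \oo, avg a L N (ind (cube y r)) <= (4 * r / ell) ^+ d.
Proof.
move=> r0.
have : \forall N \near \oo, (N.+1%:R)^-1 < r / ell.
  have := @cvg_harmonic R; move/cvgrPdist_lt => /(_ (r / ell)).
  rewrite divr_gt0 // => /(_ isT); apply: filterS => N.
  by rewrite sub0r normrN gtr0_norm ?invr_gt0.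
apply: filterS => N hN; rewrite avg_cubeE.
have NR : (0 : R) < N.+1%:R by rewrite ltr0n.
rewrite -[X in _ <= _ ^+ X]card_ord -prodr_const; apply: ler_prod => i _.
apply/andP; split.
  by rewrite divr_ge0 ?ler0n // sumr_ge0.
rewrite ler_pdivrMr //; apply: le_trans (count_itv_le _ _) _.
  by rewrite ler_pM2r ?invr_gt0 // ler_pM2l //; lra.
have : 1 <= r / ell * N.+1%:R by rewrite -ler_pdivrMr // mul1r ltW.
have -> : N.+1%:R * (y 0 i - a 0 i + r) / ell - N.+1%:R * (y 0 i - a 0 i - r) / ell
   = 2 * (r / ell * N.+1%:R) by field; rewrite gt_eqF.
by rewrite mulrAC -mulrA; lra.
Qed.

(** The cube lies inside the box, so no index is cut off at either end, and 2 r (N + 1) / ell - 1 is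
    at least r (N + 1) / ell for large N. *)
Lemma avg_cube_ge (y : V) (r : R) : 0 < r ->
  (forall i, a 0 i + r <= y 0 i <= a 0 i + ell - r) ->
  \forall N \near \oo, (r / ell) ^+ d <= avg a L N (ind (cube y r)).
Proof.
move=> r0 yr.
have : \forall N \near \oo, (N.+1%:R)^-1 < r / ell.
  have := @cvg_harmonic R; move/cvgrPdist_lt => /(_ (r / ell)).
  rewrite divr_gt0 // => /(_ isT); apply: filterS => N.
  by rewrite sub0r normrN gtr0_norm ?invr_gt0.
apply: filterS => N hN; rewrite avg_cubeE.
have NR : (0 : R) < N.+1%:R by rewrite ltr0n.
rewrite -[X in _ ^+ X <= _]card_ord -prodr_const; apply: ler_prod => i _.
rewrite divr_ge0 ?(ltW r0) ?(ltW ell_gt0) //= ler_pdivlMr //.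
have /andP[y1 y2] := yr i.
apply: le_trans (count_itv_ge _ _).
- have : 1 <= r / ell * N.+1%:R by rewrite -ler_pdivrMr // mul1r ltW.
  have -> : N.+1%:R * (y 0 i - a 0 i + r) / ell - N.+1%:R * (y 0 i - a 0 i - r) / ell
    = 2 * (r / ell * N.+1%:R) by field; rewrite gt_eqF.
  by lra.
- by rewrite divr_ge0 ?(ltW ell_gt0) // mulr_ge0 //; lra.
- by rewrite ler_pdivrMr // ler_pM2l //; lra.
Qed.

End GridCount.

Section Slab.
Context {R : realType} {d : nat}.
Notation V := 'rV[R]_d.
Variables (a L : V).
Hypothesis L_gt0 : forall i, 0 < L 0 i.

Lemma C1on_smoothstep (D : set V) f (c e : R) : open D -> C1on D f ->
  C1on D (fun x => smoothstep (c + e * f x)) /\ forall x, D x -> forall i,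
    pd i (fun x => smoothstep (c + e * f x)) x
    = dsmoothstep (c + e * f x) * e * pd i f x.
Proof.
move=> oD fD.
apply: (@C1on_comp R d D f (fun s => smoothstep (c + e * s))
  (fun s => dsmoothstep (c + e * s) * e) oD fD) => s.
  apply: (@is_derive_comp1 R R (fun s => c + e * s) smoothstep s 1 e).
    rewrite -[X in is_derive _ _ _ X]add0r -{2}[e]mulr1.
    by apply: is_deriveD; exact: is_deriveZ.
  exact: is_derive_smoothstep.
apply: (@continuous_atM R R (fun s => dsmoothstep (c + e * s)) (fun=> e)); last exact: continuous_at_cst.
apply: (@continuous_comp _ _ _ (fun s : R => c + e * s)); last exact: dsmoothstep_continuous.
apply: (@continuous_atD R R (fun=> c) (fun s => e * s)); first exact: continuous_at_cst.
by apply: (@continuous_atM R R (fun=> e) (fun s => s)); [exact: continuous_at_cst|exact: cvg_id].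
Qed.

(** The scaling 1/2 + phi / (4 delta) sends the slab |phi| <= delta into this interval. *)
Lemma dsmoothstep_ge1 (s : R) : 1 / 4 <= s <= 3 / 4 -> 1 <= dsmoothstep s.
Proof.
rewrite /dsmoothstep => /andP[? ?].
have [[? ->]|[? ->]] := pospartP s; have [[? ->]|[? ->]] := pospartP (s - 1/2);
have [[? ->]|[? ->]] := pospartP (s - 1); lra.
Qed.

(* The slab is bounded by integrating by parts: the derivative of
   smoothstep (1/2 + phi / (4 delta)) across the level set is of order
   1 / delta on the slab, and its integral against a bump is bounded. *)
Lemma avg_slab (U : set V) (phi : V -> R) (y : V) (j : 'I_d) :
  open U -> U y -> in_obox a L y -> C1on U phi -> pd j phi y != 0 ->
  exists rho C : R, [/\ 0 < rho, 0 < C, ball y rho `<=` U & forall delta : R, 0 < delta ->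
    \forall N \near \oo,
      avg a L N (ind [set x | ball y rho x /\ `|phi x| <= delta]) <= C * delta].
Proof.
move=> oU Uy yB phiC pj0.
(* The sign s makes the derivative across the level set positive, and half of its value at y is a
   lower bound near y. *)
pose s : R := Num.sg (pd j phi y); pose m := `|pd j phi y| / 2.
have m0 : 0 < m by rewrite divr_gt0 // normr_gt0.
have [r r0 Hr] : exists2 r : R, 0 < r & forall x, ball y r x ->
    [/\ U x, in_obox a L x & m <= s * pd j phi x].
  have [_ /(_ j)[_ /cvgrPdist_lt /(_ m m0)]] := phiC y Uy.
  move=> /nbhs_ballP[r1 /= r10 H1].
  have /nbhs_ballP[r2 /= r20 H2] := open_nbhs_nbhs (conj oU Uy).
  pose r3 := \big[Num.min/1]_i Num.min (y 0 i - a 0 i) (a 0 i + L 0 i - y 0 i).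
  have r30 : 0 < r3.
    rewrite /r3; apply: lt_bigmin => // i _; rewrite lt_min.
    by have /andP[? ?] := yB i; apply/andP; split; lra.
  exists (Num.min r1 (Num.min r2 r3)); first by rewrite !lt_min r10 r20.
  move=> x yx; split.
  - by apply: H2; apply: le_ball yx; rewrite !ge_min lexx !orbT.
  - have /(ballP _ _ r30) yx3 : ball y r3 x.
      by apply: le_ball yx; rewrite !ge_min lexx !orbT.
    move=> i; have := yx3 i.
    have : r3 <= Num.min (y 0 i - a 0 i) (a 0 i + L 0 i - y 0 i) by exact: bigmin_le.
    rewrite le_min ltr_norml => /andP[? ?] /andP[? ?].
    by apply/andP; split; lra.
  - have : ball y r1 x by apply: le_ball yx; rewrite ge_min lexx.
    move=> /H1 /=.
    have -> : `|pd j phi y - pd j phi x| = `|s * (pd j phi y - pd j phi x)|.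
      by rewrite normrM normr_sg pj0 mul1r.
    have : s * pd j phi y = m * 2 by rewrite /s -normrEsg /m divfK // pnatr_eq0.
    rewrite mulrBr => ->; rewrite ltr_norml => /andP[? ?]; lra.
(* The bump is 1 up to rho and 0 from 2 rho on; the factor 4 leaves room for it to vanish in a
   neighbourhood of every point outside the ball of radius r. *)
pose rho := r / 4; have rho0 : 0 < rho by rewrite divr_gt0.
pose B : R := 4 * d%:R / rho.
have B0 : 0 <= B by rewrite divr_ge0 ?mulr_ge0 ?ler0n // ltW.
(* The average A of the slab will satisfy m e A - B < 1 with e = 1 / (4 delta). *)
exists rho, (4 * (B + 1) / m); split=> //.
- by rewrite divr_gt0 // mulr_gt0 // ltr_wpDl.
- move=> x yx; have rr : rho <= r by rewrite /rho; lra.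
  by have [] := Hr x (le_ball rr yx).
move=> delta delta0.
pose e := (4 * delta)^-1; have e0 : 0 < e by rewrite invr_gt0 mulr_gt0.
pose D : set V := ball y r; have oD : open D by exact: ball_open.
have DU : D `<=` U by move=> x /Hr[].
have [bC bd] := bump_C1 y rho0.
have [gC gd] := C1on_smoothstep (1/2) e oD (C1on_sub DU phiC).
pose g x := s * (smoothstep (1/2 + e * phi x) * bump y rho x).
have bCD : C1on D (bump y rho) by apply: C1on_sub bC.
have gbC := C1onM oD gC bCD.
have gCD : C1on D g by apply: (C1onM oD (C1on_cst s) gbC).
have lim := @avg_pd_zero_ext R d a L L_gt0 D g j oD.
have /lim /(_ gCD) {}lim : D `<=` [set x | in_obox a L x] by move=> x /Hr[].
have {}lim : avg a L N (fun x => if x \in D then pd j g x else 0) @[N --> \oo] --> 0.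
  apply: lim => z nDz; have : nbhs z (ball z rho) by exact: nbhsx_ballx.
  apply: filterS => x zx _; rewrite /g bump0 ?mulr0 // => yx; apply: nDz.
  have : ball y (2 * rho + rho) z by apply: (ball_triangle yx); exact: ball_sym.
  by apply: le_ball; rewrite /rho; lra.
have : \forall N \near \oo, avg a L N (fun x => if x \in D then pd j g x else 0) < 1.
  by apply: (cvgr_lt 0).
apply: filterS => N hN.
(* The term with the derivative of the step is nonnegative, and at least m e on the slab; the term
   with the derivative of the bump is bounded by B. *)
have key x : m * e * ind [set x | ball y rho x /\ `|phi x| <= delta] x - B
    <= (if x \in D then pd j g x else 0).
  have [Dx|nDx] := pselect (D x); last first.
    rewrite memNset // ind0 ?mulr0 ?sub0r ?oppr_le0 // => -[yx _]; apply: nDx.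
    by apply: le_ball yx; rewrite /rho; lra.
  rewrite mem_set // /g.
  have dg := ((gC x Dx).2 j).1; have db := ((bCD x Dx).2 j).1.
  rewrite (pdZ _ (derivable_mul dg db)) (pdM dg db) (gd x Dx).
  have [_ _ mx] := Hr x Dx.
  have /andP[S0 S1] := smoothstep_itv (1/2 + e * phi x).
  have /andP[b0 b1] := bump_itv y rho x.
  have /andP[D0 D1] := dsmoothstep_itv (1/2 + e * phi x).
  rewrite mulrDr [leRHS]addrC; apply: lerD.
    have -> : s * (bump y rho x * (dsmoothstep (1 / 2 + e * phi x) * e * pd j phi x))
      = e * (dsmoothstep (1 / 2 + e * phi x) * bump y rho x * (s * pd j phi x)).
      by ring.
    rewrite -mulrA mulrCA ler_pM2l //.
    have P0 : 0 <= dsmoothstep (1 / 2 + e * phi x) * bump y rho x by rewrite mulr_ge0.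
    have [[yx px]|nx] := pselect ([set x | ball y rho x /\ `|phi x| <= delta] x).
      rewrite ind1 // mulr1 bump1 // mulr1.
      have : 1 <= dsmoothstep (1 / 2 + e * phi x).
        have ed : e * delta = 1 / 4 by rewrite /e; field; rewrite gt_eqF.
        move: px; rewrite ler_norml => /andP[p1 p2].
        have := ler_wpM2l (ltW e0) p1; have := ler_wpM2l (ltW e0) p2.
        rewrite mulrN ed => ? ?.
        by apply: dsmoothstep_ge1; apply/andP; split; lra.
      move=> D1'; rewrite -[leLHS]mul1r; apply: ler_pM => //; exact: ltW.
    rewrite ind0 // mulr0 mulr_ge0 //; exact: le_trans (ltW m0) mx.
  rewrite lerNl; apply: le_trans (ler_norm _) _.
  have ns : `|s| = 1 by rewrite normr_sg pj0.
  rewrite normrN 2!normrM ns (ger0_norm S0) -[leRHS]mul1r.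
  apply: ler_pM; rewrite ?mulr_ge0 //.
  by apply: le_trans (bd x j); rewrite ler_piMl.
have := @ler_avg R d a L L_gt0 N _ _ (fun x _ => key x).
rewrite avgB avgZ avg_cst => h.
have : m * e * avg a L N (ind [set x | ball y rho x /\ `|phi x| <= delta]) <= B + 1.
  by lra.
have me0 : 0 < m * e by exact: mulr_gt0.
rewrite mulrC -(ler_pdivlMr _ _ me0).
suff -> : (B + 1) / (m * e) = 4 * (B + 1) / m * delta by [].
have -> : delta = e^-1 / 4 by rewrite /e invrK mulrAC divff ?mul1r ?pnatr_eq0.
by rewrite invfM; field; rewrite (gt_eqF m0) (gt_eqF e0).
Qed.

End Slab.

Section Compactness.
Context {R : realType}.

Lemma bounded_on_compact (T : topologicalType) (K : set T) (f : T -> R) :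
  compact K -> {within K, continuous f} ->
  exists2 M : R, 0 < M & forall x, K x -> `|f x| <= M.
Proof.
move=> Kc fc; have [M [_ HM]] := compact_bounded (continuous_compact fc Kc).
exists (Num.max 1 (M + 1)); first by rewrite lt_max ltr01.
move=> x Kx; apply: (HM (Num.max 1 (M + 1))); last by exists x.
by rewrite lt_max ltrDl ltr01 orbT.
Qed.

Lemma bounded_continuous_on_compact (T : topologicalType) (K : set T) (f : T -> R) :
  compact K -> continuous f ->
  exists2 M : R, 0 < M & forall x, K x -> `|f x| <= M.
Proof. by move=> Kc fc; apply: bounded_on_compact => //; exact: continuous_subspaceT. Qed.

Lemma cvg_sum_seq (T I : Type) (F : set_system T) {FF : Filter F} (r : seq I)
    (f : I -> T -> R) (l : I -> R) : (forall i, f i x @[x --> F] --> l i) ->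
  (\sum_(i <- r) f i x) @[x --> F] --> \sum_(i <- r) l i.
Proof.
move=> H; elim: r => [|i r IH].
  rewrite big_nil; have -> : (fun x : T => \sum_(i <- [::]) f i x) = (fun=> 0).
    by apply/funext => x; rewrite big_nil.
  exact: cvg_cst.
rewrite big_cons; have -> : (fun x : T => \sum_(i <- i :: r) f i x)
    = (fun x => f i x + \sum_(i <- r) f i x).
  by apply/funext => x; rewrite big_cons.
exact: cvgD.
Qed.

Lemma eq_cvgn (u v : nat -> R) (l : R) :
  u =1 v -> u N @[N --> \oo] --> l -> v N @[N --> \oo] --> l.
Proof. by move=> /funext ->. Qed.

End Compactness.

(** * Tangent fields with constant divergence *)

Section ConstantDivergence.
Context {R : realType} {d : nat}.
Notation V := 'rV[R]_d.
Variables (a : V) (ell : R) (Omega : set V) (F : V -> V) (c : R).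
Notation L := (const_mx ell : V).
Hypothesis ell_gt0 : 0 < ell.
Hypothesis Omega_open : open Omega.
Hypothesis Omega_box : closure Omega `<=` [set x | in_obox a L x].
Hypothesis F_within :
  forall i, {within closure Omega, continuous (fun x => F x 0 i)}.
Hypothesis F_C1 : forall i, C1on Omega (fun x => F x 0 i).
Hypothesis div_F : forall x, Omega x -> div F x = c.
Hypothesis F_tangent : forall y nu, closure Omega y ->
  outward_unit_normal Omega y nu -> dot (F y) nu = 0.
Implicit Types (zeta f g : V -> R).

Let L_gt0 i : 0 < L 0 i. Proof. by rewrite mxE. Qed.

Lemma compact_closure_box : compact (closure Omega).
Proof.
apply: (@subclosed_compact _ _ [set x : V | forall i, a 0 i <= x 0 i <= (a + L) 0 i]).
- exact: closed_closure.
- exact: compact_box.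
- move=> x /Omega_box H i; have /andP[? ?] := H i.
  by rewrite mxE; apply/andP; split; exact: ltW.
Qed.

(* The integrand of the weak form of the divergence theorem,
   \int_Omega div (zeta F) = 0; [null_test zeta] is its grid version. *)
Definition test_div zeta (x : V) : R :=
  if x \in Omega then \sum_i pd i (fun z => zeta z * F z 0 i) x else 0.

Definition null_test zeta := avg a L N (test_div zeta) @[N --> \oo] --> 0.

Lemma test_divE zeta x : C1on Omega zeta -> Omega x ->
  test_div zeta x = \sum_i pd i zeta x * F x 0 i + c * zeta x.
Proof.
move=> zC Ox; rewrite /test_div mem_set // -(div_F Ox) /div mulrC mulr_sumr.
rewrite -big_split /=; apply: eq_bigr => i _.
rewrite (pdM ((zC x Ox).2 i).1 ((F_C1 i Ox).2 i).1) addrC.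
by rewrite [_ * pd i zeta x]mulrC.
Qed.

Lemma test_div_out zeta x : ~ Omega x -> test_div zeta x = 0.
Proof. by move=> nO; rewrite /test_div memNset. Qed.

Lemma near_complement x : ~ closure Omega x -> \forall y \near x, ~ Omega y.
Proof.
move=> nx; have : nbhs x (~` closure Omega).
  apply: open_nbhs_nbhs; split=> //; apply: closed_openC; exact: closed_closure.
by apply: filterS => y ny Oy; apply: ny; exact: subset_closure.
Qed.

Lemma avg0_sum (I : Type) (r : seq I) (f : I -> V -> R) :
  (forall i, avg a L N (f i) @[N --> \oo] --> 0) ->
  avg a L N (fun x => \sum_(i <- r) f i x) @[N --> \oo] --> 0.
Proof.
move=> H; have FF : Filter (\oo : set_system nat) by typeclasses eauto.
have := @cvg_sum_seq R nat I \oo FF r _ (fun=> 0) H.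
rewrite big1 //; apply: eq_cvgn => N.
by rewrite avg_sum.
Qed.

Lemma null_test_zero_ext zeta : C1on Omega zeta ->
  (forall y, ~ Omega y -> \forall x \near y, Omega x -> zeta x = 0) ->
  null_test zeta.
Proof.
move=> zC z0.
have H i : avg a L N (fun x => if x \in Omega
    then pd i (fun z => zeta z * F z 0 i) x else 0) @[N --> \oo] --> 0.
  apply: avg_pd_zero_ext => //.
  - by move=> x Ox; apply: Omega_box; exact: subset_closure.
  - exact: C1onM.
  - by move=> y /z0; apply: filterS => x h /h ->; rewrite mul0r.
apply: cvg_trans (avg0_sum (index_enum _) H).
apply: near_eq_cvg; apply: nearW => N; apply: eq_avg => x.
by rewrite /test_div; case: ifP => // _; rewrite big1.
Qed.

Lemma null_testD f g : C1on Omega f -> C1on Omega g ->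
  null_test f -> null_test g -> null_test (fun x => f x + g x).
Proof.
move=> fC gC f0 g0.
have : (avg a L N (test_div f) + avg a L N (test_div g)) @[N --> \oo] --> (0 + 0 : R).
  exact: cvgD.
rewrite addr0; apply: eq_cvgn => N; rewrite -avgD; apply: eq_avg => x.
have [Ox|nOx] := pselect (Omega x); last by rewrite !test_div_out // addr0.
rewrite /test_div mem_set // -big_split /=; apply: eq_bigr => i _.
have fF := C1onM Omega_open fC (F_C1 i); have gF := C1onM Omega_open gC (F_C1 i).
rewrite -(pdD ((fF x Ox).2 i).1 ((gF x Ox).2 i).1).
by congr (pd i _ x); apply/funext => z; rewrite mulrDl.
Qed.

(** At a zero of phi in K and in the closure of [Omega], phi itself witnesses that its normalized
    gradient is an outward normal, so F is orthogonal to the gradient. Continuity of F up to the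
    boundary extends this to nearby points of [Omega]. Near points with phi nonzero a small delta
    leaves nothing to prove, and compactness gives one delta for K. *)
Lemma normal_flux_small (K U : set V) (phi : V -> R) (eta : R) :
  compact K -> open U -> K `<=` U -> C1on U phi -> Ck U U 1 phi ->
  (forall x, K x -> grad phi x != 0) ->
  (forall x, U x -> Omega x <-> phi x < 0) -> 0 < eta ->
  \forall delta \near 0^'+, forall x, K x -> Omega x -> `|phi x| <= delta ->
    `|\sum_i pd i phi x * F x 0 i| <= eta.
Proof.
move=> Kc oU KU pC pCk pg pO eta0.
apply: (@compact_near_uniform R V K R 0^'+ (fun delta x => Omega x ->
  `|phi x| <= delta -> `|\sum_i pd i phi x * F x 0 i| <= eta) _ Kc) => x Kx.
have [px0|px0] := eqVneq (phi x) 0; last first.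
  have px : 0 < `|phi x| / 2 by rewrite divr_gt0 // normr_gt0.
  have [/cvgrPdist_lt /(_ _ px) /nbhs_ballP[r /= r0 Hr] _] := pC x (KU x Kx).
  exists r => //; near=> delta => y /Hr /= py _ _ pyd; exfalso.
  have dd : delta < `|phi x| / 2 by near: delta; exact: nbhs_right_lt.
  have := ler_normB (phi x - phi y) (- phi y); rewrite opprK subrK normrN.
  by lra.
have [Cx|nCx] := pselect (closure Omega x); last first.
  have /nbhs_ballP[r /= r0 Hr] := near_complement nCx.
  by exists r => //; apply: nearW => delta y /Hr.
have G0 : \sum_i pd i phi x * F x 0 i = 0.
  have : dot (F x) ((enorm (grad phi x))^-1 *: grad phi x) = 0.
    apply: F_tangent => //; exists U, phi; split; split=> //; [exact: KU|exact: pg].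
  have -> : dot (F x) ((enorm (grad phi x))^-1 *: grad phi x)
     = (enorm (grad phi x))^-1 * \sum_i pd i phi x * F x 0 i.
    by rewrite /dot mulr_sumr; apply: eq_bigr => i _; rewrite !mxE; ring.
  move=> /eqP; rewrite mulf_eq0 invr_eq0 => /orP[|/eqP //].
  rewrite /enorm sqrtr_eq0 => gx; exfalso.
  have /negP := pg x Kx; apply; apply/eqP/rowP => i; rewrite [RHS]mxE.
  have : dot (grad phi x) (grad phi x) = 0.
    by apply/eqP; rewrite eq_le gx /= sumr_ge0 // => j _; rewrite -expr2 sqr_ge0.
  move=> /eqP; rewrite psumr_eq0 => [/allP /(_ i)|j _]; last by rewrite -expr2 sqr_ge0.
  by rewrite mem_index_enum => /(_ isT); rewrite mulf_eq0 orbb => /eqP.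
have FW : Filter (within (closure Omega) (nbhs x)) by exact: within_filter.
have H i : (fun z : V => pd i phi z * F z 0 i) z @[z --> within (closure Omega) (nbhs x)]
    --> pd i phi x * F x 0 i.
  apply: cvgM.
    by apply: cvg_within_filter; exact: ((pC x (KU x Kx)).2 i).2.
  exact: (subspace_continuousP _ _).1 (@F_within i) x Cx.
have := @cvg_sum_seq R V 'I_d _ FW (index_enum _) _ _ H; rewrite G0 => cvG.
move/cvgrPdist_le : cvG => /(_ _ eta0); rewrite near_withinE => /nbhs_ballP[r /= r0 Hr].
exists r => //; apply: nearW => delta y /Hr yH _ Oy _.
by have := yH (subset_closure Oy); rewrite sub0r normrN.
Unshelve. all: by end_near. Qed.

Lemma Ck1_C1on (D K : set V) k f : open D -> D `<=` K -> Ck D K k.+1 f ->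
  C1on D f.
Proof.
move=> oD DK [fc fd].
have H i := cid (fd (unitv i)).
apply: (proj1 (@C1on_intro R d D f (fun i => projT1 (H i)) oD _)) => x Dx.
have nK : nbhs x K.
  by have := open_nbhs_nbhs (conj oD Dx); apply: filterS; exact: DK.
split; first exact: within_continuous_at fc nK.
move=> i; case: (H i) => g /= [gk gd]; split; first exact: gd.
by apply: within_continuous_at nK; case: k gk {fd H gd} => [|k] [].
Qed.

Lemma C1at_near_eq f g x :
  {near x, f =1 g} -> C1on [set x] f -> C1on [set x] g.
Proof.
move=> fg fC _ ->; have [cf Hf] := fC x erefl.
split; first exact: continuous_near_eq fg cf.
move=> i; split; first exact: near_eq_derivable fg (Hf i).1.
apply: continuous_near_eq (Hf i).2.
by have := near_join fg; apply: filterS => z zfg; exact: pd_near.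
Qed.

Lemma bump_near0 (y : V) (rho : R) (z : V) : 0 < rho -> ~ ball y (3 * rho) z ->
  \forall x \near z, bump y rho x = 0.
Proof.
move=> rho0 yz; have : nbhs z (ball z rho) by exact: nbhsx_ballx.
apply: filterS => x zx; apply: bump0 => // yx; apply: yz.
have : ball y (2 * rho + rho) z by apply: (ball_triangle yx); exact: ball_sym.
by apply: le_ball; lra.
Qed.

Lemma within_flux zeta : C1on setT zeta ->
  {within closure Omega, continuous
    (fun x => \sum_i pd i zeta x * F x 0 i + c * zeta x)}.
Proof.
move=> zC; apply/subspace_continuousP => x Cx.
have FW : Filter (within (closure Omega) (nbhs x)) by exact: within_filter.
have H i : (fun z : V => pd i zeta z * F z 0 i) z
    @[z --> within (closure Omega) (nbhs x)] --> pd i zeta x * F x 0 i.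
  apply: cvgM.
    by apply: cvg_within_filter; exact: ((zC x I).2 i).2.
  exact: (subspace_continuousP _ _).1 (@F_within i) x Cx.
apply: cvgD; first exact: (@cvg_sum_seq R V 'I_d _ FW (index_enum _) _ _ H).
by apply: cvgMr; apply: cvg_within_filter; exact: (zC x I).1.
Qed.

(** The test function bz is multiplied by a cutoff chi along the levels of phi. The product vanishes
    near the complement of [Omega], hence is null; the difference lives on the slab, of average at
    most Cc delta, and is bounded there by M plus the normal flux eta times the gradient 4 / delta.
    The second part leaves 4 Z Cc eta whatever delta is, so eta is fixed before delta. *)
Lemma boundary_null_test (y : V) : closure Omega y -> ~ Omega y ->
  (exists nu, outward_unit_normal Omega y nu) ->
  exists2 rho : R, 0 < rho & forall zeta, C1on setT zeta ->
    null_test (fun x => bump y rho x * zeta x).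
Proof.
move=> Cy nOy [nu [U [phi [[oU Uy pCk] [py pg pO _]]]]].
have pC : C1on U phi by exact: Ck1_C1on pCk.
have [j pj0] : exists j, pd j phi y != 0.
  apply/not_existsP => H; move/negP: pg; apply; apply/eqP/rowP => i.
  by rewrite !mxE; apply/eqP/negPn/negP; exact: H.
have [r0 r00 Hr0] : exists2 r : R, 0 < r & forall x, ball y r x -> U x /\ pd j phi x != 0.
  have [_ /(_ j)[_ /cvgrPdist_lt /(_ `|pd j phi y|)]] := pC y Uy.
  rewrite normr_gt0 => /(_ pj0) /nbhs_ballP[r1 /= r10 H1].
  have /nbhs_ballP[r2 /= r20 H2] := open_nbhs_nbhs (conj oU Uy).
  exists (Num.min r1 r2); first by rewrite lt_min r10.
  move=> x yx; split; first by apply: H2; apply: le_ball yx; rewrite ge_min lexx orbT.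
  have : ball y r1 x by apply: le_ball yx; rewrite ge_min lexx.
  by move=> /H1 /=; apply: contraTneq => ->; rewrite subr0 ltxx.
pose U1 : set V := ball y r0.
have U1U : U1 `<=` U by move=> x /Hr0[].
have [rho1 [Cc [rho10 Cc0 BU1 slab]]] := @avg_slab R d a L L_gt0 U1 phi y j
  (ball_open y r0) (ballxx y r00) (Omega_box Cy) (C1on_sub U1U pC) pj0.
have BU : ball y rho1 `<=` U by move=> x /BU1/U1U.
(* A compact set between the support of the bump below, of radius 2 rho = rho1 / 4, and the ball on
   which phi is controlled. *)
pose K := cube y (rho1 / 2).
have KB : K `<=` ball y rho1.
  by move=> x Kx; apply/ballP => // i; have := Kx i; rewrite distrC; lra.
have Kg x : K x -> grad phi x != 0.
  move=> /KB/BU1/Hr0[_]; apply: contra_neq => /rowP /(_ j).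
  by rewrite !mxE.
pose rho := rho1 / 8; have rho0 : 0 < rho by rewrite divr_gt0.
exists rho => // zeta zC.
have [bC _] := bump_C1 y rho0.
pose bz x := bump y rho x * zeta x.
have bzC : C1on setT bz := C1onM openT bC zC.
have bzO : C1on Omega bz by apply: C1on_sub bzC.
have near0 z : ~ ball y rho1 z -> \forall x \near z, bz x = 0.
  move=> yz; have yz' : ~ ball y (3 * rho) z.
    by move=> h; apply: yz; apply: le_ball h; rewrite /rho; lra.
  by apply: filterS (bump_near0 rho0 yz') => x; rewrite /bz => ->; rewrite mul0r.
have [M M0 HM] := bounded_on_compact compact_closure_box (within_flux bzC).
have [Z Z0 HZ] := bounded_continuous_on_compact compact_closure_box (C1on_continuous bzC).
apply/cvgrPdist_le => /= e e0.
(* The error e is split in thirds: the flux part W eta, the part Cc M delta, and the average of the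
   test with chi. *)
pose W := 4 * Z * Cc; have W0 : 0 < W by rewrite !mulr_gt0.
pose eta := e / (3 * W); have eta0 : 0 < eta by rewrite divr_gt0 // mulr_gt0.
have KU : K `<=` U by move=> x /KB/BU.
have nf : \forall delta \near 0^'+, forall x, K x -> Omega x -> `|phi x| <= delta ->
    `|\sum_i pd i phi x * F x 0 i| <= eta.
  by apply: (@normal_flux_small K U) => //; exact: compact_cube.
have [delta [delta0 flux dM]] : exists delta : R, [/\ 0 < delta,
    forall x, K x -> Omega x -> `|phi x| <= delta ->
      `|\sum_i pd i phi x * F x 0 i| <= eta & delta <= e / (3 * (Cc * M))].
  near (0 : R)^'+ => delta; exists delta; split.
  - by near: delta; exact: nbhs_right_gt.
  - near: delta.
    exact: nf.
  - near: delta; apply: nbhs_right_le; rewrite divr_gt0 // !mulr_gt0 //.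
(* With this slope chi is 1 where phi <= - delta and 0 where phi >= - delta / 2. *)
pose k := - (2 / delta).
have [chiC chid] := C1on_smoothstep (-1) k oU pC.
pose chi x := smoothstep (-1 + k * phi x).
pose zeta1 x := chi x * bz x.
have near1 z : ~ ball y rho1 z -> \forall x \near z, zeta1 x = 0.
  by move=> /near0; apply: filterS => x; rewrite /zeta1 => ->; rewrite mulr0.
have z1B : C1on (ball y rho1) zeta1.
  apply: C1onM; first exact: ball_open.
    exact: C1on_sub BU chiC.
  by apply: C1on_sub bzC.
have z1C : C1on Omega zeta1.
  move=> x Ox; have [Bx|nBx] := pselect (ball y rho1 x); first exact: z1B.
  apply: (@C1at_near_eq (fun=> 0) zeta1 x) => //; last exact: C1on_cst.
  by apply: filterS (near1 x nBx) => z ->.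
have lim1 : null_test zeta1.
  apply: null_test_zero_ext => // z nOz.
  (* Outside [Omega] but in the ball phi is nonnegative, so nearby it exceeds - delta / 2 and chi is
     0; away from the ball the bump is 0. *)
  have [Bz|nBz] := pselect (ball y rho1 z); last first.
    by apply: filterS (near1 z nBz) => x ->.
  have Uz := BU z Bz.
  have pz : 0 <= phi z by rewrite leNgt; apply/negP => /(pO z Uz).
  have d2 : 0 < delta / 2 by rewrite divr_gt0.
  have /cvgrPdist_lt /(_ _ d2) := (pC z Uz).1.
  apply: filterS => x /=; rewrite ltr_norml => /andP[px1 px2] _.
  rewrite /zeta1 /chi smoothstep0 ?mul0r // /k mulNr subr_le0 lerNl.
  have -> : 2 / delta * phi x = phi x / (delta / 2) by field; rewrite gt_eqF.
  by rewrite -mulNr ler_pdivrMr //; lra.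
pose S : set V := [set x | ball y rho1 x /\ `|phi x| <= delta].
have P0 : 0 < Z * (4 / delta) * eta.
  by apply: mulr_gt0 => //; apply: mulr_gt0 => //; rewrite divr_gt0.
have C0 : 0 <= M + Z * (4 / delta) * eta by apply: addr_ge0; exact: ltW.
have key x : `|test_div bz x - test_div zeta1 x| <= (M + Z * (4 / delta) * eta) * ind S x.
  have [i0 i1] := andP (ind_itv S x).
  have [Ox|nOx] := pselect (Omega x); last first.
    by rewrite !test_div_out // subrr normr0 mulr_ge0.
  rewrite !test_divE //; have Cx := subset_closure Ox.
  have [Bx|nBx] := pselect (ball y rho1 x); last first.
    have z0 : zeta1 x = 0 := nbhs_singleton (near1 x nBx).
    have b0 : bz x = 0 := nbhs_singleton (near0 x nBx).
    rewrite z0 b0 !big1 ?subrr ?normr0 ?mulr_ge0 // => i _.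
      rewrite (@pd_near _ _ zeta1 (fun=> 0)) ?pd_cst ?mul0r //.
      by apply: filterS (near1 x nBx) => z ->.
    rewrite (@pd_near _ _ bz (fun=> 0)) ?pd_cst ?mul0r //.
    by apply: filterS (near0 x nBx) => z ->.
  have Ux := BU x Bx; have px : phi x < 0 by apply/pO.
  pose G := \sum_i pd i bz x * F x 0 i; pose Q := \sum_i pd i phi x * F x 0 i.
  have E : \sum_i pd i zeta1 x * F x 0 i
      = chi x * G + bz x * dsmoothstep (-1 + k * phi x) * k * Q.
    rewrite /G /Q !mulr_sumr -big_split /=; apply: eq_bigr => i _.
    rewrite (pdM ((chiC x Ux).2 i).1 ((bzC x I).2 i).1) (chid x Ux).
    by rewrite /chi; ring.
  have -> : \sum_i pd i bz x * F x 0 i + c * bz x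
      - (\sum_i pd i zeta1 x * F x 0 i + c * zeta1 x)
    = (1 - chi x) * (G + c * bz x)
      - bz x * dsmoothstep (-1 + k * phi x) * k * Q.
    by rewrite E -/G /zeta1; ring.
  have dl : 2 / delta * delta = 2 by rewrite divfK // gt_eqF.
  have k20 : 0 < 2 / delta by rewrite divr_gt0.
  have [pd1|pd1] := leP `|phi x| delta; last first.
    have arg1 : 1 <= -1 + k * phi x.
      rewrite ltr0_norm // in pd1; have := ler_wpM2l (ltW k20) (ltW pd1).
      by rewrite dl /k mulNr mulrN; lra.
    rewrite /chi smoothstep1 // dsmoothstep_eq0; last by right.
    by rewrite subrr mulr0 !mul0r subr0 normr0 mulr_ge0.
  rewrite (@ind1 R d S x) // mulr1; apply: le_trans (ler_normB _ _) _.
  apply: lerD.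
    rewrite normrM -[leRHS]mul1r; apply: ler_pM => //; last exact: HM.
    have /andP[? ?] := smoothstep_itv (-1 + k * phi x).
    by rewrite /chi ger0_norm; lra.
  (* The flux bound is known only on K, but off K the factor bz in front of the flux is 0. *)
  have [Kx|nKx] := pselect (K x); last first.
    rewrite {1}/bz bump0 ?mul0r ?normr0 //; last first.
      have r20 : 0 < 2 * rho by rewrite mulr_gt0.
      move=> /(ballP _ _ r20) H; apply: nKx => i.
      by have := H i; rewrite distrC /rho; lra.
    exact: ltW.
  have HZx := HZ x Cx; move: (bz x) HZx => bx HZx.
  rewrite !normrM; apply: ler_pM; rewrite ?mulr_ge0 //; last exact: flux.
  rewrite -mulrA; apply: ler_pM; rewrite ?mulr_ge0 //.
  have -> : 4 / delta = 2 * (2 / delta) by ring.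
  have /andP[? ?] := dsmoothstep_itv (-1 + k * phi x).
  have -> : `|k| = 2 / delta by rewrite /k normrN gtr0_norm.
  by rewrite ger0_norm // ler_wpM2r // ltW.
have e3 : 0 < e / 3 by rewrite divr_gt0.
have := slab delta delta0.
move/cvgrPdist_le : lim1 => /(_ _ e3); apply: filterS2 => N.
rewrite !sub0r !normrN -/S => l1 l2.
have -> : avg a L N (test_div bz) = avg a L N (fun x => test_div bz x - test_div zeta1 x)
    + avg a L N (test_div zeta1) by rewrite avgB subrK.
apply: le_trans (ler_normD _ _) _.
have : `|avg a L N (fun x => test_div bz x - test_div zeta1 x)|
    <= (M + Z * (4 / delta) * eta) * (Cc * delta).
  apply: le_trans (ler_norm_avg _ _ _ _) _.
  apply: le_trans (@ler_avg R d a L L_gt0 N _ _ (fun x _ => key x)) _.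
  by rewrite avgZ ler_wpM2l.
have -> : (M + Z * (4 / delta) * eta) * (Cc * delta) = Cc * M * delta + W * eta.
  by rewrite /W; field; rewrite gt_eqF.
have -> : W * eta = e / 3 by rewrite /eta; field; rewrite gt_eqF.
have : Cc * M * delta <= e / 3.
  rewrite mulrC -ler_pdivlMr ?mulr_gt0 //; apply: le_trans dM _.
  by rewrite invfM mulrA.
by lra.
Unshelve. all: by end_near. Qed.

(** This replaces a partition of unity: zeta = b zeta + (1 - b) zeta for each bump b, where the
    first part is null by assumption and the second is again a test function, to which the induction
    applies. *)
Lemma null_test_peel (s : seq (V * R)) :
  (forall p, p \in s -> 0 < p.2 /\ forall zeta, C1on setT zeta ->
     null_test (fun x => bump p.1 p.2 x * zeta x)) ->
  forall zeta, C1on setT zeta ->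
    null_test (fun x => \prod_(p <- s) (1 - bump p.1 p.2 x) * zeta x) ->
    null_test zeta.
Proof.
elim: s => [_ zeta _|p s IH H zeta zC].
  by congr (null_test _); apply/funext => x; rewrite big_nil mul1r.
have [p0 Hp] := H p (mem_head _ _); have [bC _] := bump_C1 p.1 p0.
have cbC : C1on setT (fun x => (1 - bump p.1 p.2 x) * zeta x).
  by apply: (C1onM openT _ zC); apply: (C1onB openT _ bC); exact: C1on_cst.
have E : (fun x => \prod_(p <- p :: s) (1 - bump p.1 p.2 x) * zeta x)
    = (fun x => \prod_(p <- s) (1 - bump p.1 p.2 x) * ((1 - bump p.1 p.2 x) * zeta x)).
  by apply/funext => x; rewrite big_cons; ring.
rewrite E => /IH; have ps q : q \in s -> 0 < q.2 /\ forall zeta, C1on setT zeta ->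
     null_test (fun x => bump q.1 q.2 x * zeta x).
  by move=> qs; apply: H; rewrite in_cons qs orbT.
move=> /(_ ps cbC) n2.
have -> : zeta = (fun x => bump p.1 p.2 x * zeta x + (1 - bump p.1 p.2 x) * zeta x).
  by apply/funext => x; ring.
apply: null_testD; last exact: n2.
- by apply: C1on_sub (C1onM openT bC zC).
- by apply: C1on_sub cbC.
- exact: Hp.
Qed.

(** The boundary points near which zeta does not vanish identically form a compact set of regular
    points, covered by finitely many balls. Each bump is 1 on its ball, so what remains after
    peeling vanishes near all boundary points. *)
Lemma null_test_near_regular (zeta : V -> R) : C1on setT zeta ->
  (forall y, closure Omega y -> ~ Omega y ->
    ~ (exists nu, outward_unit_normal Omega y nu) ->
    \forall x \near y, zeta x = 0) ->
  null_test zeta.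
Proof.
move=> zC z0.
pose Z : set V := [set y | \forall x \near y, zeta x = 0].
have oZ : open Z by rewrite openE => y /near_join.
pose K := closure Omega `&` (~` Omega `&` ~` Z).
have Kc : compact K.
  apply: compact_closedI; first exact: compact_closure_box.
  by apply: closedI; exact: open_closedC.
pose Q := [set p : V * R | 0 < p.2 /\ forall zeta, C1on setT zeta ->
     null_test (fun x => bump p.1 p.2 x * zeta x)].
have Kcov : K `<=` cover Q (fun p : V * R => ball p.1 p.2).
  move=> y [Cy [nOy nZy]].
  have [|rho rho0 Hrho] := boundary_null_test Cy nOy.
    by apply: contrapT => nn; apply: nZy; exact: z0.
  by exists (y, rho) => //=; exact: ballxx.
move: Kc; rewrite compact_cover => /(_ _ Q (fun p : V * R => ball p.1 p.2)).
move=> /(_ (fun p _ => ball_open p.1 p.2) Kcov) [D' D'Q D'cov].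
have [s sQ scov] : exists2 s : seq (V * R), (forall p, p \in s -> Q p) &
    forall y, K y -> exists2 p, p \in s & ball p.1 p.2 y.
  exists (finmap.enum_fset D') => [p /D'Q|y Ky]; first by rewrite inE.
  by have [p pD yp] := D'cov y Ky; exists p.
apply: (null_test_peel sQ zC); apply: null_test_zero_ext => //.
  apply: C1on_sub (C1onM openT _ zC) => //.
  (* [C1on_prod] asks for the regularity of every factor, also for pairs outside s, whose radius may
     not be positive; 1 is a harmless default. *)
  pose rad (p : V * R) := if 0 < p.2 then p.2 else 1.
  have rad0 p : 0 < rad p by rewrite /rad; case: ifP.
  have [p|p x|C _ _ _] := @C1on_prod R d setT _ s (fun p x => 1 - bump p.1 (rad p) x) openT.
  - apply: (C1onB openT); first exact: C1on_cst.
    by have [] := bump_C1 p.1 (rad0 p).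
  - by have /andP[? ?] := bump_itv p.1 (rad p) x; apply/andP; split; lra.
  congr (C1on _ _): C; apply/funext => x; rewrite !big_seq.
  by apply: eq_bigr => p /sQ [p0 _]; rewrite /rad p0.
move=> y nOy; have [Cy|nCy] := pselect (closure Omega y); last first.
  by have := near_complement nCy; apply: filterS => x nx /nx.
have [Zy|nZy] := pselect (Z y).
  by apply: filterS Zy => x -> _; rewrite mulr0.
have [p ps yp] := scov y (conj Cy (conj nOy nZy)).
have p0 := (sQ p ps).1.
have := open_nbhs_nbhs (conj (ball_open p.1 p.2) yp); apply: filterS => x xp _.
rewrite (big_rem p) //= bump1 // subrr !mul0r //.
Qed.

Lemma bump_pd0 (y : V) (rho : R) x i : 0 < rho -> ~ cube y (2 * rho) x ->
  pd i (bump y rho) x = 0.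
Proof.
move=> rho0 nx.
have cK : closed (cube y (2 * rho)).
  by apply: compact_closed; [exact: norm_hausdorff|exact: compact_cube].
rewrite (@pd_near _ _ (bump y rho) (fun=> 0)) ?pd_cst //.
have := open_nbhs_nbhs (conj (closed_openC cK) nx); apply: filterS => z nz.
have r20 : 0 < 2 * rho by rewrite mulr_gt0.
apply: bump0 => // /(ballP y z r20) H; apply: nz => j.
by have := H j; rewrite distrC => /ltW.
Qed.

(* The set without normals is cut off by bumps on small balls; the cutoff costs
   a gradient of order 1 / r on a set of volume r ^ d for each ball. *)
Lemma constant_divergence_eq0 : (0 < d)%N -> Omega !=set0 ->
  surface_null [set y | (closure Omega `\` Omega) y /\
                        ~ exists nu, outward_unit_normal Omega y nu] -> c = 0.
Proof.
move=> d0 [x0 Ox0] null; apply/eqP/negPn/negP => cn0.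
have /nbhs_ballP[r1 /= r10 Hr1] := open_nbhs_nbhs (conj Omega_open Ox0).
pose r0 := r1 / 2; have r00 : 0 < r0 by rewrite divr_gt0.
have cO : cube x0 r0 `<=` Omega.
  move=> x cx; apply: Hr1; apply/ballP => // i; rewrite distrC.
  by apply: le_lt_trans (cx i) _; rewrite /r0; lra.
have box0 i : a 0 i + r0 <= x0 0 i <= a 0 i + ell - r0.
  have side (e : R) : `|e| <= r0 -> a 0 i < x0 0 i + e < a 0 i + ell.
    move=> er; have : cube x0 r0 (x0 + e *: unitv i).
      move=> j; rewrite mxE mxE unitvE addrAC subrr add0r.
      by case: eqP => _; rewrite ?mulr1 ?mulr0 ?normr0 // ltW.
    move=> /cO /subset_closure /Omega_box /(_ i).
    have -> : (x0 + e *: unitv i) 0 i = x0 0 i + e by rewrite mxE mxE unitvE eqxx mulr1.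
    by have -> : L 0 i = ell by rewrite mxE.
  have n1 : `|r0| <= r0 by rewrite ger0_norm // ltW.
  have n2 : `|- r0| <= r0 by rewrite normrN.
  have /andP[_ ?] := side r0 n1; have /andP[? _] := side (- r0) n2.
  by apply/andP; split; lra.
have Fsum : {within closure Omega, continuous (fun x => \sum_i `|F x 0 i|)}.
  apply/subspace_continuousP => x Cx.
  have FW : Filter (within (closure Omega) (nbhs x)) by exact: within_filter.
  apply: (@cvg_sum_seq R V 'I_d _ FW (index_enum _) (fun i z => `|F z 0 i|)
    (fun i => `|F x 0 i|)) => i.
  by apply: cvg_norm; exact: (subspace_continuousP _ _).1 (@F_within i) x Cx.
have [M M0 HM] := bounded_on_compact compact_closure_box Fsum.
have c0 : 0 < `|c| by rewrite normr_gt0.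
(* A ball of radius r <= 1 costs |c| + 4 d M / r, at most A / r, on a cube of average at most (8 r /
   ell) ^ d; the product is at most B r ^ (d - 1). *)
pose A := `|c| + 4 * d%:R * M.
have A0 : 0 < A by rewrite ltr_pwDl // !mulr_ge0 // ltW.
pose B := (8 / ell) ^+ d * A.
have B0 : 0 < B by rewrite mulr_gt0 // exprn_gt0 // divr_gt0.
pose q := `|c| * (r0 / ell) ^+ d.
have q0 : 0 < q by rewrite mulr_gt0 // exprn_gt0 // divr_gt0.
(* The 1 keeps the radii below 1; the other bound makes the total cost at most q / 4. With q / 4 for
   the null test this contradicts the lower bound q. *)
pose eta := Num.min 1 (q / 4 / B).
have eta0 : 0 < eta by rewrite lt_min ltr01 !divr_gt0.
have [m [cc [r [r01 cov sumr]]]] := null eta eta0.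
have rpos k : 0 < r k by have /andP[] := r01 k.
have r1' k : r k <= 1.
  have /andP[_ h] := r01 k; apply: le_trans (ltW h) _.
  by rewrite ge_min lexx.
pose f (k : 'I_m) x := 1 - bump (cc k) (r k) x.
have fC k : C1on setT (f k).
  by apply: (C1onB openT); [exact: C1on_cst|have [] := bump_C1 (cc k) (rpos k)].
have f01 k x : 0 <= f k x <= 1.
  by have /andP[? ?] := bump_itv (cc k) (r k) x; rewrite /f; apply/andP; split; lra.
have [psiC psi01 psid psi1] := C1on_prod (index_enum 'I_m) openT fC f01.
pose psi x := \prod_(k <- index_enum 'I_m) f k x.
have npsi : null_test psi.
  apply: null_test_near_regular => // y Cy nOy nnu.
  have [k _ yk] := cov y (conj (conj Cy nOy) nnu).
  have := open_nbhs_nbhs (conj (ball_open (cc k) (r k)) yk); apply: filterS => x xk.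
  rewrite /psi (big_rem k) ?mem_index_enum //= /f bump1 // subrr mul0r //.
pose S k := cube (cc k) (2 * r k).
have b_ind k x : bump (cc k) (r k) x <= ind (S k) x.
  have [Sx|nSx] := pselect (S k x).
    by rewrite ind1 //; have /andP[] := bump_itv (cc k) (r k) x.
  have /andP[i0 _] := ind_itv (S k) x; rewrite bump0 //.
  have r20 : 0 < 2 * r k by rewrite mulr_gt0.
  move=> /(ballP _ _ r20) H; apply: nSx => j.
  by have := H j; rewrite distrC => /ltW.
have db_ind k x i : `|pd i (f k) x| <= 4 * d%:R / r k * ind (S k) x.
  have [bC bd] := bump_C1 (cc k) (rpos k).
  rewrite /f (pdB (derivable_cst _ _ _) ((bC x I).2 i).1) pd_cst sub0r normrN.
  have [Sx|nSx] := pselect (S k x); first by rewrite ind1 // mulr1.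
  by rewrite bump_pd0 // normr0 ind0 // mulr0.
(* Where psi is locally 1 the integrand is c; both its defect c (1 - psi) and the gradient term are
   charged to the cubes [S k]. *)
have key x : `|c| * ind (cube x0 r0) x <= Num.sg c * test_div psi x
    + \sum_k (`|c| + M * (4 * d%:R / r k)) * ind (S k) x.
  have S0 : 0 <= \sum_k (`|c| + M * (4 * d%:R / r k)) * ind (S k) x.
    apply: sumr_ge0 => k _; have /andP[? _] := ind_itv (S k) x.
    by rewrite mulr_ge0 // addr_ge0 // mulr_ge0 ?(ltW M0) // divr_ge0 ?(ltW (rpos k)) // mulr_ge0.
  have [Ox|nOx] := pselect (Omega x); last first.
    by rewrite test_div_out // mulr0 add0r ind0 ?mulr0 // => /cO.
  rewrite test_divE //; last exact: C1on_sub psiC.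
  have Cx := subset_closure Ox.
  pose G := \sum_i pd i psi x * F x 0 i.
  have cpart : `|c| * (1 - psi x) <= \sum_k `|c| * ind (S k) x.
    rewrite -mulr_sumr ler_wpM2l //; apply: le_trans (psi1 x) _.
    by apply: ler_sum => k _; rewrite /f opprB addrC subrK.
  have Gpart : `|G| <= \sum_k M * (4 * d%:R / r k) * ind (S k) x.
    have db i : `|pd i psi x| <= \sum_k 4 * d%:R / r k * ind (S k) x.
      by apply: le_trans (psid x I i) _; apply: ler_sum => k _; exact: db_ind.
    apply: le_trans (ler_norm_sum _ _ _) _.
    apply: (@le_trans _ _ (\sum_i `|F x 0 i| * \sum_k 4 * d%:R / r k * ind (S k) x)).
      by apply: ler_sum => i _; rewrite normrM mulrC ler_wpM2l.
    rewrite -mulr_suml; under [leRHS]eq_bigr do rewrite -mulrA.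
    rewrite -mulr_sumr; apply: ler_wpM2r.
      by apply: le_trans (db (Ordinal d0)).
    by apply: le_trans (HM x Cx); rewrite ler_norm.
  have -> : \sum_k (`|c| + M * (4 * d%:R / r k)) * ind (S k) x
     = \sum_k `|c| * ind (S k) x + \sum_k M * (4 * d%:R / r k) * ind (S k) x.
    by rewrite -big_split /=; apply: eq_bigr => k _; rewrite mulrDl.
  have cs : Num.sg c * c = `|c| by rewrite normrEsg.
  have Gs : - `|G| <= Num.sg c * G.
    rewrite lerNl; apply: le_trans (ler_norm _) _.
    by rewrite normrN normrM normr_sg cn0 mul1r.
  have -> : Num.sg c * (\sum_i pd i psi x * F x 0 i + c * psi x)
    = Num.sg c * G + `|c| * psi x by rewrite mulrDr mulrA cs.
  have : `|c| * ind (cube x0 r0) x <= `|c|.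
    by have /andP[_ h] := ind_itv (cube x0 r0) x; rewrite ler_piMr.
  by move: cpart; rewrite mulrBr mulr1; lra.
have q4 : 0 < q / 4 by rewrite divr_gt0.
have vol : \forall N \near \oo, forall k,
    avg a L N (ind (S k)) <= (4 * (2 * r k) / ell) ^+ d.
  by apply: filter_forall => k; apply: avg_cube_le => //; rewrite mulr_gt0.
have vol0 := avg_cube_ge ell_gt0 r00 box0.
have [N [h1 h2 h3]] : exists N, [/\ `|avg a L N (test_div psi)| <= q / 4,
    forall k, avg a L N (ind (S k)) <= (4 * (2 * r k) / ell) ^+ d &
    (r0 / ell) ^+ d <= avg a L N (ind (cube x0 r0))].
  move/cvgrPdist_le : npsi => /(_ _ q4) npsi.
  near \oo => N; exists N; split.
  - by rewrite -normrN -[- _]sub0r; near: N.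
  - by near: N.
  - by near: N.
have := @ler_avg R d a L L_gt0 N _ _ (fun x _ => key x).
rewrite avgZ avgD avgZ avg_sum => main.
have l1 : q <= `|c| * avg a L N (ind (cube x0 r0)) by rewrite ler_wpM2l.
have l2 : Num.sg c * avg a L N (test_div psi) <= q / 4.
  apply: le_trans (ler_norm _) _.
  by rewrite normrM normr_sg cn0 mul1r.
have l3 : \sum_k avg a L N (fun x => (`|c| + M * (4 * d%:R / r k)) * ind (S k) x)
    <= B * \sum_k r k ^+ d.-1.
  rewrite mulr_sumr; apply: ler_sum => k _; rewrite avgZ.
  have ck : 0 <= `|c| + M * (4 * d%:R / r k).
    by rewrite addr_ge0 // mulr_ge0 ?(ltW M0) // divr_ge0 ?(ltW (rpos k)) // mulr_ge0.
  apply: le_trans (ler_wpM2l ck (h2 k)) _.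
  have -> : 4 * (2 * r k) / ell = 8 / ell * r k by field; rewrite gt_eqF.
  rewrite exprMn mulrCA /B -[leRHS]mulrA ler_pM2l ?exprn_gt0 ?divr_gt0 //.
  have -> : r k ^+ d = r k * r k ^+ d.-1 by rewrite -exprS prednK.
  rewrite mulrA ler_wpM2r ?exprn_ge0 ?(ltW (rpos k)) //.
  have -> : (`|c| + M * (4 * d%:R / r k)) * r k = `|c| * r k + 4 * d%:R * M.
    by field; rewrite gt_eqF.
  by rewrite /A lerD2r ler_piMr.
have l4 : B * \sum_k r k ^+ d.-1 <= q / 4.
  rewrite mulrC -ler_pdivlMr //; apply: le_trans (ltW sumr) _.
  by rewrite ge_min lexx orbT.
by lra.
Unshelve. all: by end_near. Qed.

End ConstantDivergence.

(** * The periodic case *)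

Section PeriodicDivergence.
Context {R : realType} {d : nat}.
Notation V := 'rV[R]_d.

Lemma periodic_divergence_eq0 (L : V) (F : V -> V) (c : R) :
  (forall i, 0 < L 0 i) -> Defs.periodic L F ->
  (forall i, C1on setT (fun x => F x 0 i)) -> (forall x, div F x = c) -> c = 0.
Proof.
move=> L0 perF FC divF.
have H i : avg 0 L N (pd i (fun x => F x 0 i)) @[N --> \oo] --> 0.
  by apply: avg_pd => // x _ _; rewrite perF.
have FF : Filter (\oo : set_system nat) by typeclasses eauto.
have := @cvg_sum_seq R nat 'I_d \oo FF (index_enum _) _ (fun=> 0) H.
rewrite big1 // => c0; have {c0} : (fun _ : nat => c) N @[N --> \oo] --> (0 : R).
  apply: eq_cvgn c0 => N; rewrite -avg_sum -[RHS](avg_cst 0 L N).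
  by apply: eq_avg => x; rewrite -(divF x).
by move=> /(cvg_unique _ (cvg_cst c)) -> //; exact: norm_hausdorff.
Qed.

End PeriodicDivergence.

(** * Vanishing gradients *)

Section VanishingGradient.
Context {R : realType} {d : nat}.
Notation V := 'rV[R]_d.
Implicit Types (f : V -> R).

(** The parametrization by s t with s in [0, 1] allows either sign of t; for t < 0 the mean value
    theorem is applied from the other end. *)
Lemma constant_on_line f (v x : V) (t : R) :
  (forall s, 0 <= s <= 1 -> is_derive (x + (s * t) *: v) v f 0) ->
  f (x + t *: v) = f x.
Proof.
move=> H.
have [t0|t0] := leP 0 t.
  suff D s : 0 <= s <= t -> is_derive (x + s *: v) v f 0.
    have [s _] := @mvt_line R V f (fun=> 0) x v t t0 D.
    by rewrite mulr0 => /eqP; rewrite subr_eq0 => /eqP.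
  move=> st.
  have [t00|tn0] := eqVneq t 0.
    have -> : s = 0 * t by move: st; rewrite t00 => /andP[? ?]; lra.
    by apply: H; rewrite lexx ler01.
  have tp : 0 < t by rewrite lt_def tn0.
  rewrite -(divfK tn0 s); apply: H; have /andP[? ?] := st.
  by rewrite divr_ge0 //= ler_pdivrMr // mul1r.
have nt0 : 0 <= - t by rewrite oppr_ge0 ltW.
suff D s : 0 <= s <= - t -> is_derive (x + t *: v + s *: v) v f 0.
  have [s _] := @mvt_line R V f (fun=> 0) (x + t *: v) v (- t) nt0 D.
  rewrite mulr0 -addrA -scalerDl subrr scale0r addr0 => /eqP.
  by rewrite subr_eq0 => /eqP.
move=> st.
rewrite -addrA -scalerDl.
have -> : t + s = (1 + s / t) * t by rewrite mulrDl mul1r divfK // lt_eqF.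
apply: H; have /andP[? ?] := st.
have : - 1 <= s / t <= 0.
  by rewrite ler_ndivlMr // ler_ndivrMr // mul0r mulN1r; apply/andP.
by move=> /andP[? ?]; apply/andP; split; lra.
Qed.

(** The coordinates of x0 are replaced one at a time by those of x. The intermediate segments stay
    in the ball because it is a cube in the sup norm. *)
Lemma constant_on_ball f (x0 : V) (r : R) :
  (forall z, ball x0 r z -> forall i, is_derive z (unitv i) f 0) ->
  forall x, ball x0 r x -> f x = f x0.
Proof.
move=> H x x0x; have r0 : 0 < r by case: x0x.
have xi := (ballP _ _ r0).1 x0x.
pose p (e : seq 'I_d) : V := \row_j (if j \in e then x 0 j else x0 0 j).
have pE : p (enum 'I_d) = x by apply/rowP => j; rewrite mxE mem_enum.
have p0 : p [::] = x0 by apply/rowP => j; rewrite mxE.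
rewrite -pE -[in RHS]p0; elim: (enum 'I_d) => // i e IH; rewrite -IH.
have [ie|nie] := boolP (i \in e).
  congr f; apply/rowP => j; rewrite !mxE in_cons.
  by case: eqP => // ->; rewrite ie.
have -> : p (i :: e) = p e + (x 0 i - x0 0 i) *: unitv i.
  apply/rowP => j; rewrite !mxE in_cons eqxx /=.
  by case: eqP => [->|_]; rewrite /= ?(negbTE nie) ?mulr1 ?mulr0 ?addr0 // addrC subrK.
apply: constant_on_line => s /andP[s0 s1]; apply: H; apply/ballP => // j.
rewrite !mxE eqxx /=; case: eqP => [->|_] /=.
  rewrite (negbTE nie) mulr1 opprD addrA subrr sub0r normrN normrM.
  by apply: le_lt_trans (xi i); rewrite distrC ler_piMl // ger0_norm.
by rewrite mulr0 addr0; case: ifP => _ //; rewrite subrr normr0.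
Qed.

Lemma constant_of_grad0 (D : set V) f : open D -> connected D ->
  (forall z, D z -> forall i, is_derive z (unitv i) f 0) ->
  forall x y, D x -> D y -> f x = f y.
Proof.
move=> oD cD H x y Dx Dy.
have lc z : D z -> exists2 r : R, 0 < r & ball z r `<=` D /\ forall w, ball z r w -> f w = f z.
  move=> Dz; have /nbhs_ballP[r /= r0 Hr] := open_nbhs_nbhs (conj oD Dz).
  exists r => //; split=> //; apply: constant_on_ball => w /Hr; exact: H.
(* Both truth values at once: the level set of f through y and its complement in D are open, so
   connectedness applies. *)
have op (b : bool) : open [set z | D z /\ (f z == f y) = b].
  rewrite openE => z [Dz fz]; have [r r0 [rD rf]] := lc z Dz.
  by apply/nbhs_ballP; exists r => // w zw; split; [exact: rD|rewrite rf].
have E : [set z | D z /\ (f z == f y) = true] = D.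
  apply: cD.
  - by exists y; rewrite /= eqxx.
  - by exists [set z | D z /\ (f z == f y) = true] => //; apply/seteqP; split=> z [].
  - exists (~` [set z | D z /\ (f z == f y) = false]); first exact: open_closedC.
    apply/seteqP; split=> z /=; first by move=> [Dz ->]; split=> // -[_].
    by move=> [Dz nz]; split=> //; case: eqP nz => // _ []; split.
by have : [set z | D z /\ (f z == f y) = true] x by [rewrite E]; case=> _ /eqP.
Qed.

Lemma constant_of_grad0_setT f :
  (forall z i, is_derive z (unitv i) f 0) -> forall x y, f x = f y.
Proof.
move=> H x y; pose r := 1 + \sum_i `|y 0 i - x 0 i|.
have r0 : 0 < r by rewrite ltr_wpDr // sumr_ge0.
apply/esym; apply: (@constant_on_ball f x r (fun z _ => H z)).
apply/ballP => // i; rewrite distrC /r (bigD1 i) //=.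
have : 0 <= \sum_(j < d | j != i) `|y 0 j - x 0 j| by rewrite sumr_ge0.
by lra.
Qed.

End VanishingGradient.

(** * Both boundary conditions together *)

Section DivergenceOnSettings.
Context {R : realType} {d : nat}.
Notation V := 'rV[R]_d.

Lemma region_open (s : setting R d) : setting_ok s -> open (region s).
Proof. by case: s => [Om [[]]|L _] //=; exact: openT. Qed.

Lemma norm_coord_le (x : V) i : `|x 0 i| <= `|x|.
Proof.
rewrite [leRHS]/Num.Def.normr /= mx_normrE.
by apply: le_trans; last exact: (le_bigmax _ _ (0, i)).
Qed.

Lemma bounded_in_cube (A : set V) : bounded_set A ->
  exists2 B : R, 0 < B & A `<=` cube 0 B.
Proof.
move=> [M [Mr HM]].
pose B := Num.max 1 (M + 1); have B0 : 0 < B by rewrite lt_max ltr01.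
exists B => // x Ax i; rewrite mxE subr0; apply: le_trans (norm_coord_le x i) _.
by apply: (HM B _ x Ax); rewrite lt_max ltrDl ltr01 orbT.
Qed.

Lemma constant_on_region (s : setting R d) (f : V -> R) : setting_ok s ->
  (forall z, region s z -> forall i, is_derive z (unitv i) f 0) ->
  exists c, forall x, region s x -> f x = c.
Proof.
case: s => [Om [[oO cO _ [x0 Ox0]] _]|L _] /= H.
  by exists (f x0) => x Ox; exact: (constant_of_grad0 oO cO H).
exists (f 0) => x _; apply: constant_of_grad0_setT => z i; exact: H.
Qed.

Lemma setting_divergence_eq0 (s : setting R d) (F : V -> V) (c : R) :
  (0 < d)%N -> setting_ok s ->
  (forall i, {within closure (region s), continuous (fun x => F x 0 i)}) ->
  (forall i, C1on (region s) (fun x => F x 0 i)) ->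
  (forall x, region s x -> div F x = c) ->
  match s with
  | NoSlip Omega => forall y nu, closure Omega y ->
      outward_unit_normal Omega y nu -> dot (F y) nu = 0
  | Periodic L => Defs.periodic L F
  end -> c = 0.
Proof.
move=> d0; case: s => [Om [[oO cO bO O0] null]|L L0] /= Fw FC Fd Ft; last first.
  by apply: (@periodic_divergence_eq0 R d L F) => // x; exact: Fd.
have [B B0 OB] := bounded_in_cube bO.
(* The box from - 2 B to 2 B contains the closure of the domain in its interior, and its sides are
   equal as the cube counts require. *)
have ell0 : 0 < 4 * B by rewrite mulr_gt0.
apply: (@constant_divergence_eq0 R d (const_mx (- 2 * B)) (4 * B) Om F c) => //.
have cK : closed (cube 0 B : set V).
  by apply: compact_closed; [exact: norm_hausdorff|exact: compact_cube].
move=> x Cx i; have := closureS OB Cx; rewrite -(closure_id _).1 // => /(_ i).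
by rewrite !mxE subr0 ler_norml => /andP[? ?]; apply/andP; split; lra.
Qed.

End DivergenceOnSettings.

(** * Asymptotic expansions *)

Section C2Functions.
Context {R : realType} {d : nat}.
Notation V := 'rV[R]_d.
Implicit Types (D : set V) (f g : V -> R) (i : 'I_d).

Lemma C1onD D f g : open D -> C1on D f -> C1on D g -> C1on D (fun x => f x + g x).
Proof.
move=> oD fD gD.
apply: (proj1 (@C1on_intro R d D _ (fun i x => pd i f x + pd i g x) oD _)).
move=> x Dx; have [cf Hf] := fD x Dx; have [cg Hg] := gD x Dx.
split; first exact: (continuous_atD cf cg).
move=> i; have [df cdf] := Hf i; have [dg cdg] := Hg i; split.
  by apply: DeriveDef; [exact: (derivableD df dg) | exact: (pdD df dg)].
exact: (continuous_atD cdf cdg).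
Qed.

Lemma C1on_sum D (I : Type) (r : seq I) (F : I -> V -> R) : open D ->
  (forall j, C1on D (F j)) -> C1on D (fun x => \sum_(j <- r) F j x).
Proof.
move=> oD H; elim: r => [|j r IH].
  have -> : (fun x : V => \sum_(j <- [::]) F j x) = (fun=> 0).
    by apply/funext => x; rewrite big_nil.
  exact: C1on_cst.
have -> : (fun x : V => \sum_(j <- j :: r) F j x)
    = (fun x => F j x + \sum_(j <- r) F j x).
  by apply/funext => x; rewrite big_cons.
exact: (C1onD oD (H j) IH).
Qed.

Lemma is_derive_pd_sum (I : Type) (r : seq I) (F : I -> V -> R) x i :
  (forall j, derivable (F j) x (unitv i)) ->
  is_derive x (unitv i) (fun y => \sum_(j <- r) F j y) (\sum_(j <- r) pd i (F j) x).
Proof.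
move=> H; elim: r => [|j r IH].
  rewrite big_nil; have -> : (fun y : V => \sum_(j <- [::]) F j y) = cst 0.
    by apply/funext => y; rewrite big_nil.
  exact: is_derive_cst.
rewrite big_cons; have -> : (fun y : V => \sum_(j <- j :: r) F j y)
    = F j \+ (fun y => \sum_(j <- r) F j y).
  by apply/funext => y; rewrite big_cons.
by apply: is_deriveD; exact: derivableP.
Qed.

Definition C2on D f := C1on D f /\ forall i, C1on D (pd i f).

Lemma pdM_on D f g i x : C1on D f -> C1on D g -> D x ->
  pd i (fun y => f y * g y) x = f x * pd i g x + g x * pd i f x.
Proof.
by move=> fD gD Dx; rewrite (pdM ((fD x Dx).2 i).1 ((gD x Dx).2 i).1).
Qed.

Lemma C2onM D f g : open D -> C2on D f -> C2on D g ->
  C2on D (fun x => f x * g x).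
Proof.
move=> oD [f1 f2] [g1 g2]; split; first exact: (C1onM oD f1 g1).
move=> i.
have E : {in D, (fun x => f x * pd i g x + g x * pd i f x)
    =1 pd i (fun x => f x * g x)}.
  by move=> x; rewrite inE => Dx; rewrite (pdM_on i f1 g1 Dx).
exact: (C1on_eq oD E (C1onD oD (C1onM oD f1 (g2 i)) (C1onM oD g1 (f2 i)))).
Qed.

Lemma C2on_eq D f g : open D -> {in D, f =1 g} -> C2on D f -> C2on D g.
Proof.
move=> oD fg [f1 f2]; split; first exact: C1on_eq fg f1.
move=> i; apply: C1on_eq (f2 i) => // x; rewrite inE => Dx.
apply: pd_near; have := open_nbhs_nbhs (conj oD Dx); apply: filterS => y Dy.
by apply: fg; rewrite inE.
Qed.

Lemma pd_on D f g i x : open D -> {in D, f =1 g} -> D x -> pd i f x = pd i g x.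
Proof.
move=> oD fg Dx; apply: pd_near; have := open_nbhs_nbhs (conj oD Dx).
by apply: filterS => y Dy; apply: fg; rewrite inE.
Qed.

Lemma Ck2_C2on D K f : open D -> D `<=` K -> Ck D K 2 f -> C2on D f.
Proof.
move=> oD DK fk; split; first exact: (Ck1_C1on oD DK fk).
move=> i; have [_ /(_ (unitv i)) [g [gk gd]]] := fk.
apply: (@C1on_eq R d D g) => //; last exact: (@Ck1_C1on R d D K 0%N g oD DK gk).
by move=> x; rewrite inE => /gd [_ <-].
Qed.

Lemma Ck_coord (W : normedModType R) (D K : set W) k (u : W -> V) i :
  Ck D K k u -> Ck D K k (fun x => u x 0 i).
Proof.
elim: k u => [|k IH] u [uc ud]; split.
- apply/subspace_continuousP => x Kx.
  have := (subspace_continuousP _ _).1 uc x Kx => ux.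
  exact: (cvg_comp _ _ ux (@coord_continuous R 1 d 0 i (u x))).
- by [].
- apply/subspace_continuousP => x Kx.
  have := (subspace_continuousP _ _).1 uc x Kx => ux.
  exact: (cvg_comp _ _ ux (@coord_continuous R 1 d 0 i (u x))).
- move=> v; have [g [gk gd]] := ud v; exists (fun x => g x 0 i); split; first exact: IH.
  move=> x /gd [ud1 <-]; apply: DeriveDef.
    exact: (derivable_mxP u x v).1 ud1 0 i.
  by rewrite (derive_mx ud1) mxE.
Qed.

End C2Functions.

Section AsymptoticExpansions.
Context {R : realType}.

Lemma cvg_of_linear_bound (g : R -> R) (l C : R) :
  (\forall e \near 0^'+, `|g e - l| <= C * e) -> g e @[e --> 0^'+] --> l.
Proof.
move=> H; apply/cvgrPdist_le => /= eta eta0; near=> e.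
have e0 : 0 < e by near: e; exact: nbhs_right_gt.
have eC : e <= eta / (`|C| + 1).
  by near: e; apply: nbhs_right_le; rewrite divr_gt0 // ltr_wpDl.
rewrite distrC; apply: (@le_trans _ _ (C * e)); first by near: e.
move: eC; rewrite ler_pdivlMr ?ltr_wpDl // => /(le_trans _); apply.
by rewrite [leLHS]mulrC (ler_wpM2l (ltW e0)) // (le_trans (ler_norm C)) // lerDl.
Unshelve. all: by end_near. Qed.

Lemma cvg_right_unique (g : R -> R) (l l' : R) :
  g e @[e --> 0^'+] --> l -> g e @[e --> 0^'+] --> l' -> l = l'.
Proof. by move=> gl gl'; apply: (cvg_unique _ gl gl'); exact: norm_hausdorff. Qed.

Lemma cvg_right_id : (e : R) @[e --> 0^'+] --> (0 : R).
Proof. by apply: cvg_within_filter; exact: cvg_id. Qed.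

(** Since q / e ^ 2 has a limit, q and q / e tend to 0; comparison with the expansion gives c0 = 0,
    then c1 = 0, then c2 = beta by uniqueness of limits. *)
Lemma expansion_coefficients (q : R -> R) (c0 c1 c2 beta C : R) :
  (\forall e \near 0^'+, `|q e - (c0 + e * c1 + e ^+ 2 * c2)| <= C * e ^+ 3) ->
  q e / e ^+ 2 @[e --> 0^'+] --> beta -> [/\ c0 = 0, c1 = 0 & c2 = beta].
Proof.
move=> H qb.
have near_eq (f g : R -> R) (l : R) : (forall e, 0 < e -> f e = g e) ->
    f e @[e --> 0^'+] --> l -> g e @[e --> 0^'+] --> l.
  move=> fg; apply: cvg_trans; apply: near_eq_cvg; near=> e; apply: fg.
  by near: e; exact: nbhs_right_gt.
have q1 : q e / e @[e --> 0^'+] --> (0 : R).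
  have : e * (q e / e ^+ 2) @[e --> 0^'+] --> (0 * beta : R).
    by apply: cvgM => //; exact: cvg_right_id.
  by rewrite mul0r; apply: near_eq => e e0; field; rewrite gt_eqF.
have q0 : q e @[e --> 0^'+] --> (0 : R).
  have : e * (q e / e) @[e --> 0^'+] --> (0 * 0 : R).
    by apply: cvgM => //; exact: cvg_right_id.
  by rewrite mul0r; apply: near_eq => e e0; field; rewrite gt_eqF.
have c00 : c0 = 0.
  apply: cvg_right_unique q0; apply: (@cvg_of_linear_bound _ _ (`|C| + `|c1| + `|c2|)).
  near=> e; have e0 : 0 < e by near: e; exact: nbhs_right_gt.
  have e1 : e <= 1 by near: e; exact: nbhs_right_le.
  have He : `|q e - (c0 + e * c1 + e ^+ 2 * c2)| <= C * e ^+ 3 by near: e.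
  have -> : q e - c0 = (q e - (c0 + e * c1 + e ^+ 2 * c2)) + (e * c1 + e ^+ 2 * c2) by ring.
  apply: le_trans (ler_normD _ _) _; rewrite 2!mulrDl -[leRHS]addrA; apply: lerD.
    (* The sign of C is unknown; only with its absolute value can e ^ 3 be bounded by e. *)
    apply: le_trans He _; apply: (@le_trans _ _ (`|C| * e ^+ 3)).
      by rewrite ler_wpM2r ?ler_norm // exprn_ge0 // ltW.
    by rewrite ler_wpM2l // exprS ler_piMr ?(ltW e0) // exprn_ile1 // ltW.
  apply: le_trans (ler_normD _ _) _; apply: lerD.
    by rewrite normrM gtr0_norm // mulrC.
  rewrite normrM gtr0_norm ?exprn_gt0 // mulrC ler_wpM2l // expr2.
  by rewrite ler_piMr // ltW.
have c10 : c1 = 0.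
  apply: cvg_right_unique q1; apply: (@cvg_of_linear_bound _ _ (`|C| + `|c2|)).
  near=> e; have e0 : 0 < e by near: e; exact: nbhs_right_gt.
  have e1 : e <= 1 by near: e; exact: nbhs_right_le.
  have He : `|q e - (c0 + e * c1 + e ^+ 2 * c2)| <= C * e ^+ 3 by near: e.
  have -> : q e / e - c1 = (q e - (c0 + e * c1 + e ^+ 2 * c2)) / e + e * c2.
    by rewrite c00; field; rewrite gt_eqF.
  apply: le_trans (ler_normD _ _) _; rewrite [leRHS]mulrDl; apply: lerD.
    rewrite normrM (gtr0_norm (x := e^-1)) ?invr_gt0 // ler_pdivrMr //.
    apply: le_trans He _; apply: (@le_trans _ _ (`|C| * e ^+ 3)).
      by rewrite ler_wpM2r ?ler_norm // exprn_ge0 // ltW.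
    rewrite -mulrA ler_wpM2l // exprS ler_wpM2l ?(ltW e0) // expr2 ler_piMr // ltW.
  by rewrite normrM gtr0_norm // mulrC.
split=> //; apply: cvg_right_unique qb.
apply: (@cvg_of_linear_bound _ _ `|C|).
near=> e; have e0 : 0 < e by near: e; exact: nbhs_right_gt.
have He : `|q e - (c0 + e * c1 + e ^+ 2 * c2)| <= C * e ^+ 3 by near: e.
have -> : q e / e ^+ 2 - c2 = (q e - (c0 + e * c1 + e ^+ 2 * c2)) / e ^+ 2.
  by rewrite c00 c10; field; rewrite gt_eqF.
rewrite normrM (gtr0_norm (x := (e ^+ 2)^-1)) ?invr_gt0 ?exprn_gt0 //.
rewrite ler_pdivrMr ?exprn_gt0 //; apply: le_trans He _.
rewrite -mulrA -exprS ler_wpM2r ?ler_norm // exprn_ge0 // ltW //.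
Unshelve. all: by end_near. Qed.

Context {d : nat}.
Notation V := 'rV[R]_d.

(** The remainder is small with its derivatives, so the expansion may be differentiated term by
    term. *)
Lemma expansion_bound (D : set V) (f : R -> V -> R) (a : nat -> V -> R) (N : nat) :
  open D -> asymptotic_expansion D f a ->
  (\forall e \near 0^'+, C1on D (f e)) ->
  exists C, \forall e \near 0^'+, forall x, D x ->
    `|f e x - \sum_(k < N) e ^+ k * a k x| <= C * e ^+ N /\
    forall i, `|pd i (f e) x - \sum_(k < N) e ^+ k * pd i (a k) x| <= C * e ^+ N.
Proof.
move=> oD [aC fa] fC; have [C HC] := fa N; exists C.
apply: filterS2 fC HC => e fe He x Dx; have [h1 h2 _] := He x Dx.
split=> // i; have := h2 i.
have aD k : derivable (a k) x (unitv i).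
  exact: (((Ck1_C1on oD (@subset_closure _ D) (aC k)) x Dx).2 i).1.
have zD (k : 'I_N) : derivable (fun y => e ^+ k * a k y) x (unitv i).
  exact: (@derivableZ R V R (a k) (e ^+ k) x (unitv i) (aD k)).
have [sD sE] := @is_derive_pd_sum R d _ (index_enum 'I_N) (fun k y => e ^+ k * a k y) x i zD.
rewrite (pdB ((fe x Dx).2 i).1 sD) [pd i (fun _ => \sum_(k < N) _)]/pd sE.
by under eq_bigr => k _ do rewrite (pdZ _ (aD k)).
Qed.

Lemma expansion_cvg (D : set V) (f : R -> V -> R) (a : nat -> V -> R) x :
  open D -> asymptotic_expansion D f a ->
  (\forall e \near 0^'+, C1on D (f e)) -> D x ->
  f e x @[e --> 0^'+] --> a 0%N x /\
  forall i, pd i (f e) x @[e --> 0^'+] --> pd i (a 0%N) x.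
Proof.
move=> oD fa fC Dx; have [C HC] := expansion_bound 1 oD fa fC.
split=> [|i]; apply: (@cvg_of_linear_bound _ _ C); apply: filterS HC => e /(_ x Dx).
  by rewrite big_ord1 expr0 expr1 mul1r => -[].
by move=> [_ /(_ i)]; rewrite big_ord1 expr0 expr1 mul1r.
Qed.

Lemma within_le_closure (W : topologicalType) (D : set W) (g : W -> R) (M : R) x :
  {within closure D, continuous g} -> (forall y, D y -> g y <= M) ->
  closure D x -> g x <= M.
Proof.
move=> gc gM Cx; rewrite leNgt; apply/negP => Mg.
have := (subspace_continuousP _ _).1 gc x Cx; move/cvgrPdist_lt => /(_ (g x - M)).
rewrite subr_gt0 => /(_ Mg); rewrite near_withinE => H; have [y [Dy Hy]] := Cx _ H.
have : `|g x - g y| < g x - M := Hy (subset_closure Dy).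
by have := gM y Dy; rewrite ltr_norml => ? /andP[? ?]; lra.
Qed.

(** The remainder bound is given on D only; continuity carries it to the boundary, where the no-slip
    condition lives. *)
Lemma expansion_cvg_closure (D : set V) (f : R -> V -> R) (a : nat -> V -> R) x :
  asymptotic_expansion D f a ->
  (\forall e \near 0^'+, {within closure D, continuous (f e)}) -> closure D x ->
  f e x @[e --> 0^'+] --> a 0%N x.
Proof.
move=> [aC fa] fC Cx; have [C HC] := fa 1%N.
apply: (@cvg_of_linear_bound _ _ C); apply: filterS2 fC HC => e fe He.
have ca := (aC 0%N).1; apply: (@within_le_closure V D (fun y => `|f e y - a 0%N y|)) => //.
  apply/subspace_continuousP => y Cy; apply: cvg_norm; apply: cvgB.
    exact: ((subspace_continuousP _ _).1 fe y Cy).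
  exact: ((subspace_continuousP _ _).1 ca y Cy).
move=> y Dy; have [+ _ _] := He y Dy.
by rewrite big_ord1 expr0 expr1 mul1r.
Qed.

End AsymptoticExpansions.

(** * The limit of the scheme *)

Section SchemeIdentities.
Context {R : realType} {d : nat}.
Notation V := 'rV[R]_d.
Implicit Types (D : set V) (h : V -> R) (u : V -> V).

Lemma C2on_cst D (c : R) : C2on D (fun=> c).
Proof.
split; first exact: C1on_cst.
move=> i; have -> : pd i (fun _ : V => c) = (fun=> 0) by apply/funext => y; exact: pd_cst.
exact: C1on_cst.
Qed.

Lemma C2onD D (f g : V -> R) : open D -> C2on D f -> C2on D g ->
  C2on D (fun x => f x + g x).
Proof.
move=> oD [f1 f2] [g1 g2]; split; first exact: (C1onD oD f1 g1).
move=> i.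
have E : {in D, (fun x => pd i f x + pd i g x) =1 pd i (fun x => f x + g x)}.
  by move=> x; rewrite inE => Dx; rewrite (pdD ((f1 x Dx).2 i).1 ((g1 x Dx).2 i).1).
exact: (C1on_eq oD E (C1onD oD (f2 i) (g2 i))).
Qed.

Lemma flux_entry h u x k l : 0 < h x ->
  flux h u x k l = h x * (u x 0 k * u x 0 l).
Proof.
by move=> h0; rewrite /flux /tensor /discharge !mxE big_ord1 !mxE; field; rewrite gt_eqF.
Qed.

Lemma advectionE h u x k : advection h u x 0 k
  = \sum_l pd l (fun y => h y * (u y 0 k * u y 0 l)) x.
Proof.
rewrite /advection /div_mx mxE; apply: eq_bigr => l _; congr (pd l _ x).
by apply/funext => y; rewrite /tensor /discharge !mxE big_ord1 !mxE mulrA.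
Qed.

Lemma div_dischargeE h u x :
  div (discharge h u) x = \sum_i pd i (fun y => h y * u y 0 i) x.
Proof.
rewrite /div; apply: eq_bigr => i _; congr (pd i _ x).
by apply/funext => y; rewrite /discharge mxE.
Qed.

(** The expanded form contains only values and first derivatives of h and u, whose limits are known
    separately. *)
Lemma pd_triple D h u k l x : C1on D h -> (forall i, C1on D (fun y => u y 0 i)) ->
  open D -> D x ->
  pd l (fun y => h y * (u y 0 k * u y 0 l)) x
  = h x * (u x 0 k * pd l (fun y => u y 0 l) x + u x 0 l * pd l (fun y => u y 0 k) x)
    + u x 0 k * u x 0 l * pd l h x.
Proof.
move=> hC uC oD Dx; rewrite (pdM_on l hC (C1onM oD (uC k) (uC l)) Dx).
by rewrite (pdM_on l (uC k) (uC l) Dx).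
Qed.

Lemma div_mx_flux D h u x k : open D -> D x -> (forall y, D y -> 0 < h y) ->
  div_mx (flux h u) x 0 k = \sum_l pd l (fun y => h y * (u y 0 k * u y 0 l)) x.
Proof.
move=> oD Dx h0; rewrite /div_mx mxE; apply: eq_bigr => l _.
by apply: (@pd_on R d D) => // y; rewrite inE => /h0 hy; rewrite flux_entry.
Qed.

Lemma momentum_entry h u h' u' (g : V -> R) (dt : R) x k :
  dt^-1 *: (discharge h' u' x - discharge h u x) + div_mx (flux h u) x
    + h x *: grad g x = 0 ->
  dt^-1 * (h' x * u' x 0 k - h x * u x 0 k) + div_mx (flux h u) x 0 k
    + h x * pd k g x = 0.
Proof.
by move: (div_mx _ _) => M /rowP /(_ k); rewrite /discharge /grad !mxE.
Qed.

(* The divergence of the momentum equation turns the mass equation into an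
   update of the depth by the new discharge. *)
Lemma step_mass D h u h' u' b (m dt e : R) : open D -> 0 < dt ->
  C2on D h -> (forall i, C2on D (fun y => u y 0 i)) ->
  C2on D h' -> (forall i, C2on D (fun y => u' y 0 i)) -> C2on D b ->
  (forall y, D y -> 0 < h y) ->
  (forall x, D x ->
    (h' x - h x) / dt + div (discharge h u) x - dt * ddiv (flux h u) x
      - dt * div (fun y => h y *: grad (fun z => (h' z + b z - m) / e ^+ 2) y) x = 0 /\
    dt^-1 *: (discharge h' u' x - discharge h u x) + div_mx (flux h u) x
      + h x *: grad (fun z => (h' z + b z - m) / e ^+ 2) x = 0) ->
  forall x, D x -> (h' x - h x) / dt + div (discharge h' u') x = 0.
Proof.
move=> oD dt0 hC uC h'C u'C bC h0 step x Dx.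
set g := fun z => (h' z + b z - m) / e ^+ 2.
have gC : C2on D g.
  apply: (C2onM oD _ (@C2on_cst D _)); apply: (C2onD oD _ (@C2on_cst D _)).
  exact: (C2onD oD h'C bC).
have FC k l : C2on D (fun y => flux h u y k l).
  have E : {in D, (fun y => h y * (u y 0 k * u y 0 l)) =1 (fun y => flux h u y k l)}.
    by move=> y; rewrite inE => /h0 hy; rewrite flux_entry.
  exact: (C2on_eq oD E (C2onM oD hC (C2onM oD (uC k) (uC l)))).
pose A k y := \sum_l pd l (fun z => flux h u z k l) y.
pose B k y := h y * pd k g y.
have AC k : C1on D (A k) by apply: (C1on_sum _ oD) => l; exact: (FC k l).2.
have BC k : C1on D (B k) by apply: (C1onM oD hC.1); exact: gC.2.
have EC k : C1on D (fun y => h y * u y 0 k) by exact: (C1onM oD hC.1 (uC k).1).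
have E'C k : C1on D (fun y => h' y * u' y 0 k) by exact: (C1onM oD h'C.1 (u'C k).1).
have mom k : {in D, (fun y => A k y + B k y)
    =1 (fun y => dt^-1 * (h y * u y 0 k - h' y * u' y 0 k))}.
  move=> y; rewrite inE => Dy; have [_ /rowP /(_ k)] := step y Dy.
  rewrite /A /B /div_mx /discharge /grad !mxE => H.
  by apply/eqP; rewrite -subr_eq0 -[X in _ == X]H; apply/eqP; ring.
(* The momentum balance holds on an open set, so it may be differentiated at x. *)
have dmom k : pd k (A k) x + pd k (B k) x
    = dt^-1 * (pd k (fun y => h y * u y 0 k) x - pd k (fun y => h' y * u' y 0 k) x).
  have dA := ((AC k x Dx).2 k).1; have dB := ((BC k x Dx).2 k).1.
  have dE := ((EC k x Dx).2 k).1; have dE' := ((E'C k x Dx).2 k).1.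
  rewrite -(pdD dA dB) (pd_on k oD (mom k) Dx) (pdZ _ (derivable_sub dE dE')).
  by rewrite (pdB dE dE').
have [+ _] := step x Dx; rewrite !div_dischargeE -/g.
have -> : ddiv (flux h u) x = \sum_k pd k (A k) x.
  apply: eq_bigr => k _; apply/esym; apply: derive_val.
  by apply: is_derive_pd_sum => l; exact: (((FC k l).2 l x Dx).2 k).1.
have -> : \sum_i pd i (fun y => h y * grad g y 0 i) x = \sum_k pd k (B k) x.
  apply: eq_bigr => k _; congr (pd k _ x); apply/funext => y.
  by rewrite /B /grad mxE.
have : \sum_k pd k (A k) x + \sum_k pd k (B k) x = dt^-1 *
    (\sum_k pd k (fun y => h y * u y 0 k) x - \sum_k pd k (fun y => h' y * u' y 0 k) x).
  by rewrite -big_split /= -sumrB mulr_sumr; apply: eq_bigr => k _; exact: dmom.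
(* Multiplied by dt, the summed identity turns the two correction terms of the mass equation into
   the difference of the old and new discharge divergences. *)
move=> /(congr1 (fun w => dt * w)); rewrite mulVKf ?gt_eqF // mulrDr => E1 E2.
by lra.
Qed.

End SchemeIdentities.

Section FormalLimit.
Context {R : realType} {d : nat}.
Notation V := 'rV[R]_d.
Variables (s : setting R d) (mu : {measure set (borel R d) -> \bar R}).
Variables (dt : R) (b : V -> R).
Variables (h : R -> nat -> V -> R) (u : R -> nat -> V -> V).
Variables (h_ : nat -> nat -> V -> R) (u_ : nat -> nat -> V -> V).
Hypothesis d_gt0 : (0 < d)%N.
Hypothesis s_ok : setting_ok s.
Hypothesis dt_gt0 : 0 < dt.
Hypothesis b_C2 : Ck (region s) (closure (region s)) 2 b.
Hypothesis hu_C2 : forall n, \forall eps \near 0^'+,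
  Ck (region s) (closure (region s)) 2 (h eps n) /\
  Ck (region s) (closure (region s)) 2 (u eps n).
Hypothesis hu_bc : forall n, \forall eps \near 0^'+,
  boundary_condition s (h eps n) (u eps n).
Hypothesis no_dry : forall n, \forall eps \near 0^'+,
  forall x, region s x -> 0 < h eps n x.
Hypothesis no_dry0 : forall n x, region s x -> 0 < h_ n 0%N x.
Hypothesis scheme : forall n, \forall eps \near 0^'+,
  semi_implicit_step s mu b eps dt
    (h eps n) (u eps n) (h eps n.+1) (u eps n.+1).
Hypothesis h_exp : forall n,
  asymptotic_expansion (region s) (fun eps => h eps n) (h_ n).
Hypothesis u_exp : forall n,
  vector_expansion (region s) (fun eps => u eps n) (u_ n).

Let D := region s.
Let oD : open D := region_open s_ok.
Let DK : D `<=` closure D := @subset_closure _ D.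

Lemma limit_b_C2 : C2on D b.
Proof. exact: (Ck2_C2on oD DK b_C2). Qed.

Lemma limit_h_C2 n : \forall e \near 0^'+, C2on D (h e n).
Proof. by apply: filterS (hu_C2 n) => e [hk _]; exact: (Ck2_C2on oD DK hk). Qed.

Lemma limit_u_C2 n i : \forall e \near 0^'+, C2on D (fun x => u e n x 0 i).
Proof.
by apply: filterS (hu_C2 n) => e [_ uk]; exact: (Ck2_C2on oD DK (Ck_coord i uk)).
Qed.

Lemma limit_h_C1 n : \forall e \near 0^'+, C1on D (h e n).
Proof. by apply: filterS (limit_h_C2 n) => e []. Qed.

Lemma limit_u_C1 n i : \forall e \near 0^'+, C1on D (fun x => u e n x 0 i).
Proof. by apply: filterS (limit_u_C2 n i) => e []. Qed.

Lemma coeff_h_C1 n k : C1on D (h_ n k).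
Proof. exact: (Ck1_C1on oD DK ((h_exp n).1 k)). Qed.

Lemma coeff_u_C1 n k i : C1on D (fun x => u_ n k x 0 i).
Proof. exact: (Ck1_C1on oD DK ((u_exp n i).1 k)). Qed.

Lemma cvg_h n x : D x -> h e n x @[e --> 0^'+] --> h_ n 0%N x.
Proof. by move=> Dx; have [] := expansion_cvg oD (h_exp n) (limit_h_C1 n) Dx. Qed.

Lemma cvg_pd_h n x i : D x -> pd i (h e n) x @[e --> 0^'+] --> pd i (h_ n 0%N) x.
Proof. by move=> Dx; have [_] := expansion_cvg oD (h_exp n) (limit_h_C1 n) Dx; exact. Qed.

Lemma cvg_u n x i : D x -> u e n x 0 i @[e --> 0^'+] --> u_ n 0%N x 0 i.
Proof. by move=> Dx; have [] := expansion_cvg oD (u_exp n i) (limit_u_C1 n i) Dx. Qed.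

Lemma cvg_pd_u n x i j : D x -> pd j (fun y => u e n y 0 i) x @[e --> 0^'+]
  --> pd j (fun y => u_ n 0%N y 0 i) x.
Proof.
by move=> Dx; have [_] := expansion_cvg oD (u_exp n i) (limit_u_C1 n i) Dx; exact.
Qed.

Lemma cvg_near_eq (f g : R -> R) (l : R) :
  (\forall e \near 0^'+, f e = g e) -> f e @[e --> 0^'+] --> l ->
  g e @[e --> 0^'+] --> l.
Proof. by move=> fg; apply: cvg_trans; exact: near_eq_cvg. Qed.

Lemma cvg_pd_triple n x k l : D x ->
  pd l (fun y => h e n y * (u e n y 0 k * u e n y 0 l)) x @[e --> 0^'+]
  --> pd l (fun y => h_ n 0%N y * (u_ n 0%N y 0 k * u_ n 0%N y 0 l)) x.
Proof.
move=> Dx; rewrite (pd_triple k l (coeff_h_C1 n 0) (coeff_u_C1 n 0) oD Dx).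
have uC : \forall e \near 0^'+, forall i, C1on D (fun y => u e n y 0 i).
  by apply: filter_forall => i; exact: limit_u_C1.
apply: (@cvg_near_eq (fun e => h e n x *
    (u e n x 0 k * pd l (fun y => u e n y 0 l) x + u e n x 0 l * pd l (fun y => u e n y 0 k) x)
    + u e n x 0 k * u e n x 0 l * pd l (h e n) x)).
  by apply: filterS2 (limit_h_C1 n) uC => e hC eC; rewrite (pd_triple k l hC eC oD Dx).
apply: cvgD.
  apply: cvgM; first exact: cvg_h.
  apply: cvgD; apply: cvgM; by [exact: cvg_u|exact: cvg_pd_u].
apply: cvgM; last exact: cvg_pd_h.
by apply: cvgM; exact: cvg_u.
Qed.

Lemma cvg_pd_discharge n x i : D x ->
  pd i (fun y => h e n y * u e n y 0 i) x @[e --> 0^'+]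
  --> pd i (fun y => h_ n 0%N y * u_ n 0%N y 0 i) x.
Proof.
move=> Dx; rewrite (pdM_on i (coeff_h_C1 n 0) (coeff_u_C1 n 0 i) Dx).
apply: (@cvg_near_eq (fun e => h e n x * pd i (fun y => u e n y 0 i) x
    + u e n x 0 i * pd i (h e n) x)).
  by apply: filterS2 (limit_h_C1 n) (limit_u_C1 n i) => e hC uC; rewrite (pdM_on i hC uC Dx).
apply: cvgD; apply: cvgM.
- exact: cvg_h.
- exact: cvg_pd_u.
- exact: cvg_u.
- exact: cvg_pd_h.
Qed.

Lemma pd_H2 n e x k : C1on D (h e n.+1) -> D x ->
  pd k (H2 s mu b e (h e n) (h e n.+1)) x = (pd k (h e n.+1) x + pd k b x) / e ^+ 2.
Proof.
move=> hC Dx; rewrite /H2; set m := mean _ _ _.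
have dh := ((hC x Dx).2 k).1; have db := ((limit_b_C2.1 x Dx).2 k).1.
have -> : (fun y => (h e n.+1 y + b y - m) / e ^+ 2)
    = (fun y => (e ^+ 2)^-1 * ((h e n.+1 y + b y) - m)).
  by apply/funext => y; rewrite mulrC.
have dhb : derivable (fun y => h e n.+1 y + b y) x (unitv k) by exact: (derivableD dh db).
have dm : derivable (fun _ : V => m) x (unitv k) by exact: derivable_cst.
by rewrite (pdZ _ (derivable_sub dhb dm)) (pdB dhb dm) (pdD dh db) pd_cst subr0 mulrC.
Qed.

(** Solved for the pressure gradient, the momentum equation says q / eps ^ 2 = - A / h, where q is
    the level gradient and the right-hand side converges because the limit depth is positive. Thus
    [expansion_coefficients] separates the three orders; b enters only at order 0. *)
Lemma momentum_limit n x k : D x ->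
  [/\ pd k (h_ n.+1 0%N) x + pd k b x = 0, pd k (h_ n.+1 1%N) x = 0
    & dt^-1 * (h_ n.+1 0%N x * u_ n.+1 0%N x 0 k - h_ n 0%N x * u_ n 0%N x 0 k)
      + advection (h_ n 0%N) (u_ n 0%N) x 0 k
      + h_ n 0%N x * pd k (h_ n.+1 2%N) x = 0].
Proof.
move=> Dx.
pose A e := dt^-1 * (h e n.+1 x * u e n.+1 x 0 k - h e n x * u e n x 0 k)
  + \sum_l pd l (fun y => h e n y * (u e n y 0 k * u e n y 0 l)) x.
pose A0 := dt^-1 * (h_ n.+1 0%N x * u_ n.+1 0%N x 0 k - h_ n 0%N x * u_ n 0%N x 0 k)
  + advection (h_ n 0%N) (u_ n 0%N) x 0 k.
have h0 : h_ n 0%N x != 0 by rewrite gt_eqF // no_dry0.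
have cA : A e @[e --> 0^'+] --> A0.
  apply: cvgD.
    apply: cvgMr; apply: cvgB; apply: cvgM; by [exact: cvg_h|exact: cvg_u].
  rewrite advectionE.
  have FR : Filter (0^'+ : set_system R) by typeclasses eauto.
  apply: (@cvg_sum_seq R R 'I_d _ FR (index_enum _)
    (fun l e => pd l (fun y => h e n y * (u e n y 0 k * u e n y 0 l)) x) _) => l.
  exact: cvg_pd_triple.
pose q e := pd k (h e n.+1) x + pd k b x.
have cq : q e / e ^+ 2 @[e --> 0^'+] --> - A0 / h_ n 0%N x.
  apply: (@cvg_near_eq (fun e => - A e / h e n x)); last first.
    apply: cvgM; first by apply: cvgN.
    by apply: cvgV => //; exact: cvg_h.
  near=> e.
  have hC : C1on D (h e n.+1) by near: e; exact: (limit_h_C1 n.+1).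
  have hp : forall y, D y -> 0 < h e n y by near: e; exact: (no_dry n).
  have st : semi_implicit_step s mu b e dt (h e n) (u e n) (h e n.+1) (u e n.+1).
    by near: e; exact: (scheme n).
  have [_ /(momentum_entry k)] := st x Dx.
  rewrite (div_mx_flux (u e n) k oD Dx hp) (pd_H2 k hC Dx) -/(q e) => E.
  have hx := hp x Dx.
  have -> : A e = - (h e n x * (q e / e ^+ 2)).
    by apply/eqP; rewrite -subr_eq0 opprK; apply/eqP.
  by rewrite opprK mulrC mulKf // gt_eqF.
have [C HC] := expansion_bound 3 oD (h_exp n.+1) (limit_h_C1 n.+1).
have [|c0 c1 c2] := @expansion_coefficients R q (pd k (h_ n.+1 0%N) x + pd k b x)
  (pd k (h_ n.+1 1%N) x) (pd k (h_ n.+1 2%N) x) _ C _ cq.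
  apply: filterS HC => e /(_ x Dx) [_ /(_ k)].
  rewrite !big_ord_recr big_ord0 /= add0r expr0 mul1r expr1.
  by apply: le_trans; rewrite /q le_eqVlt; apply/orP; left; apply/eqP; congr `|_|; ring.
split=> //.
by rewrite -/A0 c2 mulrC divfK // subrr.
Unshelve. all: by end_near. Qed.

Lemma mass_limit n x : D x ->
  (h_ n.+1 0%N x - h_ n 0%N x) / dt + div (discharge (h_ n.+1 0%N) (u_ n.+1 0%N)) x = 0.
Proof.
move=> Dx; rewrite div_dischargeE.
pose f e := (h e n.+1 x - h e n x) / dt
  + \sum_i pd i (fun y => h e n.+1 y * u e n.+1 y 0 i) x.
apply: (@cvg_right_unique R f).
  apply: cvgD.
    by apply: cvgMl; apply: cvgB; exact: cvg_h.
  have FR : Filter (0^'+ : set_system R) by typeclasses eauto.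
  apply: (@cvg_sum_seq R R 'I_d _ FR (index_enum _)
    (fun i e => pd i (fun y => h e n.+1 y * u e n.+1 y 0 i) x) _) => i.
  exact: cvg_pd_discharge.
apply: (@cvg_near_eq (fun=> 0)); last exact: cvg_cst.
have uC m : \forall e \near 0^'+, forall i, C2on D (fun y => u e m y 0 i).
  by apply: filter_forall => i; exact: limit_u_C2.
have FR : Filter (0^'+ : set_system R) by typeclasses eauto.
have A1 := @filterI _ _ FR _ _ (limit_h_C2 n) (limit_h_C2 n.+1).
have A2 := @filterI _ _ FR _ _ (uC n) (uC n.+1).
have A3 := @filterI _ _ FR _ _ (no_dry n) (scheme n).
apply: filterS3 A1 A2 A3 => e [hC h'C] [eC e'C] [hp st].
have := step_mass oD dt_gt0 hC eC h'C e'C limit_b_C2 hp st Dx.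
by rewrite div_dischargeE.
Qed.

(** Both boundary conditions are equalities between values of the fields, so they survive the
    pointwise limit on the closure. *)
Lemma limit_boundary n :
  match s with
  | NoSlip Omega => forall y nu, closure Omega y ->
      outward_unit_normal Omega y nu ->
      dot (discharge (h_ n 0%N) (u_ n 0%N) y) nu = 0
  | Periodic L => Defs.periodic L (discharge (h_ n 0%N) (u_ n 0%N))
  end.
Proof.
have cl x : closure D x -> h e n x @[e --> 0^'+] --> h_ n 0%N x /\
    forall i, u e n x 0 i @[e --> 0^'+] --> u_ n 0%N x 0 i.
  move=> Cx; split=> [|i].
    by apply: (expansion_cvg_closure (h_exp n)) => //; apply: filterS (hu_C2 n) => e [[]].
  apply: (expansion_cvg_closure (u_exp n i)) => //.
  by apply: filterS (hu_C2 n) => e [_ /(Ck_coord i) []].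
move: cl (hu_bc n); rewrite /D; case: (s) => [Om|L] /= cl bc.
  move=> y nu Cy ny; have [_ cu] := cl y Cy.
  have FR : Filter (0^'+ : set_system R) by typeclasses eauto.
  have E : dot (u_ n 0%N y) nu = 0.
    apply: (@cvg_right_unique R (fun e => dot (u e n y) nu)).
      apply: (@cvg_sum_seq R R 'I_d _ FR (index_enum _)
        (fun i e => u e n y 0 i * nu 0 i) (fun i => u_ n 0%N y 0 i * nu 0 i)) => i.
      by apply: cvgMl; exact: cu.
    apply: (@cvg_near_eq (fun=> 0)); last exact: cvg_cst.
    by apply: filterS bc => e /(_ y nu ny).
  rewrite /dot /discharge; under eq_bigr do rewrite mxE -mulrA.
  by rewrite -mulr_sumr -/(dot _ _) E mulr0.
move=> x i; rewrite /discharge.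
have clT z : closure [set: V] z by apply: subset_closure.
have [h1 u1] := cl x (clT x); have [h2 u2] := cl _ (clT (x + L 0 i *: unitv i)).
have -> : h_ n 0%N (x + L 0 i *: unitv i) = h_ n 0%N x.
  apply: cvg_right_unique h2 _; apply: cvg_near_eq h1.
  by apply: filterS bc => e [/(_ x i)].
congr (_ *: _); apply/rowP => j; apply: cvg_right_unique (u2 j) _.
apply: cvg_near_eq (u1 j).
by apply: filterS bc => e [_ /(_ x i)] ->.
Qed.

(** The index starts at 1 since the momentum equation constrains only the new level; the initial
    level is free. *)
Lemma limit_depth n : exists H0 : R, forall x, D x -> h_ n.+1 0%N x + b x = H0.
Proof.
apply: (constant_on_region s_ok) => x Dx i; have [E _ _] := momentum_limit n i Dx.
rewrite -E; have dh := ((coeff_h_C1 n.+1 0 Dx).2 i).1.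
have db := ((limit_b_C2.1 x Dx).2 i).1.
by apply: DeriveDef; [exact: (derivableD dh db)|exact: (pdD dh db)].
Qed.

Lemma limit_step n (H0 : R) : (forall x, D x -> h_ n 0%N x + b x = H0) ->
  forall x, D x -> lake_step_op b H0 dt (h_ n 0%N) (u_ n 0%N)
    (h_ n.+1 0%N) (u_ n.+1 0%N) (h_ n.+1 2%N) x = 0.
Proof.
move=> hH0; have [H0' hH0'] := limit_depth n.
pose c := (H0 - H0') / dt.
have dc x : D x -> div (discharge (h_ n.+1 0%N) (u_ n.+1 0%N)) x = c.
  move=> Dx; have := mass_limit n Dx; rewrite /c -(hH0 x Dx) -(hH0' x Dx) => E.
  apply/eqP; rewrite -subr_eq0 -E; apply/eqP; ring.
have c0 : c = 0.
  apply: (@setting_divergence_eq0 R d s (discharge (h_ n.+1 0%N) (u_ n.+1 0%N))) => //.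
  - move=> i; have -> : (fun x => discharge (h_ n.+1 0%N) (u_ n.+1 0%N) x 0 i)
        = (fun x => h_ n.+1 0%N x * u_ n.+1 0%N x 0 i).
      by apply/funext => x; rewrite mxE.
    apply/subspace_continuousP => x Cx; apply: cvgM.
      exact: (subspace_continuousP _ _).1 ((h_exp n.+1).1 0%N).1 x Cx.
    exact: (subspace_continuousP _ _).1 ((u_exp n.+1 i).1 0%N).1 x Cx.
  - move=> i; have -> : (fun x => discharge (h_ n.+1 0%N) (u_ n.+1 0%N) x 0 i)
        = (fun x => h_ n.+1 0%N x * u_ n.+1 0%N x 0 i).
      by apply/funext => x; rewrite mxE.
    exact: (C1onM oD (coeff_h_C1 n.+1 0) (coeff_u_C1 n.+1 0 i)).
  - exact: limit_boundary.
(* c = 0 says two things at once: the new discharge is divergence free, and the level has not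
   moved. *)
have HH : H0' = H0.
  move/eqP: c0; rewrite mulf_eq0 invr_eq0 (gt_eqF dt_gt0) orbF subr_eq0.
  by move=> /eqP.
move=> x Dx; rewrite /lake_step_op dc // c0 hH0' // HH subrr.
congr (_, _); apply/rowP => k; have [_ _ E] := momentum_limit n k Dx.
by rewrite [RHS]mxE -[RHS]E !mxE.
Qed.

End FormalLimit.

(** * Consistency of the lake step *)

Section PeriodicReduction.
Context {R : realType} {d : nat}.
Notation V := 'rV[R]_d.

Lemma periodic_int (L : V) (f : V -> R) (i : 'I_d) (k : int) (x : V) :
  Defs.periodic L f -> f (x + (k%:~R * L 0 i) *: unitv i) = f x.
Proof.
move=> fL; have nat_shift (n : nat) y : f (y + (n%:R * L 0 i) *: unitv i) = f y.
  elim: n => [|n IH]; first by rewrite mul0r scale0r addr0.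
  by rewrite -natr1 mulrDl mul1r scalerDl addrA fL.
case: k => n; first exact: nat_shift.
rewrite -[in RHS](subrK ((n.+1%:R * L 0 i) *: unitv i) x) nat_shift.
by rewrite NegzE mulrNz mulNr scaleNr.
Qed.

(** Reduction modulo the periods brings every point into a compact cell, on which uniform continuity
    is available. *)
Definition cell_repr (L x : V) : V :=
  \row_i (x 0 i - (Num.floor (x 0 i / L 0 i))%:~R * L 0 i).

Lemma cell_repr_itv (L x : V) i : 0 < L 0 i -> 0 <= cell_repr L x 0 i <= L 0 i.
Proof.
move=> L0; rewrite mxE.
have := floor_le_tmp (x 0 i / L 0 i); have := floorD1_gt (x 0 i / L 0 i).
rewrite ler_pdivlMr // ltr_pdivrMr // intrD mulrDl mul1r => ? ?.
by apply/andP; split; lra.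
Qed.

Lemma periodic_cell_repr (L : V) (f : V -> R) (x : V) :
  Defs.periodic L f -> f (cell_repr L x) = f x.
Proof.
move=> fL.
pose p (e : seq 'I_d) : V := \row_j (if j \in e then cell_repr L x 0 j else x 0 j).
have pE : p (enum 'I_d) = cell_repr L x by apply/rowP => j; rewrite mxE mem_enum.
have p0 : p [::] = x by apply/rowP => j; rewrite mxE.
rewrite -pE -[in RHS]p0; elim: (enum 'I_d) => // i e IH; rewrite -IH.
have [ie|nie] := boolP (i \in e).
  congr f; apply/rowP => j; rewrite !mxE in_cons.
  by case: eqP => // ->; rewrite ie.
rewrite -(periodic_int i (- Num.floor (x 0 i / L 0 i)) (p e) fL).
congr f; apply/rowP => j; rewrite !mxE in_cons eqxx /=.
case: eqP => [->|_]; rewrite /= ?(negbTE nie) ?mulr1 ?mulr0 ?addr0 //.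
by rewrite mulrNz mulNr.
Qed.

End PeriodicReduction.

Definition space_time (R : realType) (d : nat) (s : setting R d) (T : R) :
  set (R * 'rV[R]_d) := [set z | 0 < z.1 < T /\ region s z.2].

(** * Uniform continuity in time *)

Section TimeUniformContinuity.
Context {R : realType} {d : nat}.
Notation V := 'rV[R]_d.
Variables (s : setting R d) (T : R).
Hypothesis T_gt0 : 0 < T.
Implicit Types (f g : R -> V -> R).

Notation Q := (space_time s T).

(** Boundedness is included so that the class is closed under products. All shifts r up to dt are
    allowed because the mean value theorem yields an unknown intermediate time. *)
Definition time_uniform g :=
  (exists2 M : R, 0 < M & forall t x, 0 < t < T -> region s x -> `|g t x| <= M) /\
  forall eta : R, 0 < eta -> \forall dt \near (0 : R)^'+, forall t x r, 0 < t ->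
    t + r < T -> 0 <= r <= dt -> region s x -> `|g (t + r) x - g t x| <= eta.

Lemma time_uniform_eq f g :
  (forall t x, 0 < t < T -> region s x -> f t x = g t x) ->
  time_uniform f -> time_uniform g.
Proof.
move=> fg [[M M0 HM] H]; split.
  by exists M => // t x tT Dx; rewrite -fg //; exact: HM.
move=> eta /H; apply: filterS => dt Hd t x r t0 tr rd Dx.
have /andP[r0 _] := rd.
rewrite -!fg //; first exact: Hd; apply/andP; split=> //; lra.
Qed.

Lemma time_uniformD f g : time_uniform f -> time_uniform g ->
  time_uniform (fun t x => f t x + g t x).
Proof.
move=> [[M M0 HM] Hf] [[N N0 HN] Hg]; split.
  exists (M + N); first by rewrite addr_gt0.
  by move=> t x tT Dx; apply: le_trans (ler_normD _ _) _; apply: lerD; [exact: HM|exact: HN].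
move=> eta eta0; have e2 : 0 < eta / 2 by rewrite divr_gt0.
apply: filterS2 (Hf _ e2) (Hg _ e2) => dt hf hg t x r t0 tr rd Dx.
rewrite opprD addrACA [eta]splitr; apply: le_trans (ler_normD _ _) _.
by apply: lerD; [exact: hf|exact: hg].
Qed.

Lemma time_uniformM f g : time_uniform f -> time_uniform g ->
  time_uniform (fun t x => f t x * g t x).
Proof.
move=> [[M M0 HM] Hf] [[N N0 HN] Hg]; split.
  exists (M * N); first by rewrite mulr_gt0.
  by move=> t x tT Dx; rewrite normrM; apply: ler_pM => //; [exact: HM|exact: HN].
move=> eta eta0.
have eM : 0 < eta / 2 / M by rewrite !divr_gt0.
have eN : 0 < eta / 2 / N by rewrite !divr_gt0.
apply: filterS2 (Hf _ eN) (Hg _ eM) => dt hf hg t x r t0 tr rd Dx.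
have /andP[r0 _] := rd.
have tT : 0 < t < T by apply/andP; split=> //; lra.
have trT : 0 < t + r < T by apply/andP; split=> //; lra.
have -> : f (t + r) x * g (t + r) x - f t x * g t x
  = f (t + r) x * (g (t + r) x - g t x) + (f (t + r) x - f t x) * g t x by ring.
rewrite [eta]splitr; apply: le_trans (ler_normD _ _) _; rewrite !normrM; apply: lerD.
  have -> : eta / 2 = M * (eta / 2 / M) by rewrite mulrCA divff ?mulr1 // gt_eqF.
  by apply: ler_pM => //; [exact: HM|exact: hg].
have -> : eta / 2 = (eta / 2 / N) * N by rewrite divfK // gt_eqF.
by apply: ler_pM => //; [exact: hf|exact: HN].
Qed.

Lemma time_uniform_sum (I : Type) (r : seq I) (F : I -> R -> V -> R) :
  (forall i, time_uniform (F i)) -> time_uniform (fun t x => \sum_(i <- r) F i t x).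
Proof.
move=> H; elim: r => [|i r IH].
  apply: (@time_uniform_eq (fun _ _ => 0)) => [t x _ _|]; first by rewrite big_nil.
  split; first by exists 1 => // t x _ _; rewrite normr0.
  by move=> eta eta0; apply: nearW => dt t x r _ _ _ _; rewrite subrr normr0 ltW.
apply: (@time_uniform_eq (fun t x => F i t x + \sum_(i <- r) F i t x)).
  by move=> t x _ _; rewrite big_cons.
exact: (time_uniformD (H i) IH).
Qed.

(** Only the base point has to be in K; the shifted point may leave K as long as it stays in the set
    where g is continuous. *)
Lemma uniform_on_compact (K : set (R * V)) (g : R * V -> R) (eta : R) :
  compact K -> K `<=` closure Q -> {within closure Q, continuous g} -> 0 < eta ->
  \forall dt \near (0 : R)^'+, forall z, K z -> forall r, 0 <= r <= dt ->
    closure Q (z.1 + r, z.2) -> `|g (z.1 + r, z.2) - g z| <= eta.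
Proof.
move=> Kc KQ gc eta0.
apply: (@compact_near_uniform R _ K R (0^'+) (fun dt z => forall r, 0 <= r <= dt ->
    closure Q (z.1 + r, z.2) -> `|g (z.1 + r, z.2) - g z| <= eta) _ Kc) => z Kz.
have e2 : 0 < eta / 2 by rewrite divr_gt0.
have := (subspace_continuousP _ _).1 gc z (KQ z Kz).
move/cvgrPdist_lt => /(_ _ e2); rewrite near_withinE => /nbhs_ballP[rho /= rho0 Hrho].
have r2 : 0 < rho / 2 by rewrite divr_gt0.
exists (rho / 2) => //.
near=> dt => y zy Ky r /andP[r0 rdt] Cr.
have dtr : dt < rho / 2 by near: dt; exact: nbhs_right_lt.
have [zy1 zy2] := zy.
have B1 : ball z rho y by apply: le_ball zy; lra.
have B2 : ball z rho (y.1 + r, y.2).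
  split; last by apply: le_ball zy2; lra.
  rewrite /ball /= opprD addrA; apply: le_lt_trans (ler_normB _ _) _.
  move: zy1; rewrite /ball /= => zy1; rewrite (ger0_norm r0); lra.
have P1 : `|g z - g y| < eta / 2 := Hrho _ B1 (KQ y Ky).
have P2 : `|g z - g (y.1 + r, y.2)| < eta / 2 := Hrho _ B2 Cr.
rewrite -(subrKA (g z)) (le_trans (ler_normD _ _)) // distrC.
by rewrite [eta]splitr lerD // ltW.
Unshelve. all: by end_near. Qed.

Lemma closure_time (t : R) (x : V) : 0 <= t <= T -> region s x -> closure Q (t, x).
Proof.
move=> /andP[t0 tT] Dx B /nbhs_ballP[r /= r0 Hr].
(* Moving t by the fraction k towards T / 2 enters the open interval while staying within r of t. *)
pose k := Num.min (1 / 2) (r / (2 * T)).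
have k0 : 0 < k by rewrite lt_min !divr_gt0 // mulr_gt0.
have k1 : k <= 1 / 2 by rewrite ge_min lexx.
have kr : k * T < r.
  have : k <= r / (2 * T) by rewrite ge_min lexx orbT.
  by rewrite ler_pdivlMr ?mulr_gt0 //; lra.
pose t' := t + k * (T / 2 - t).
exists (t', x); split; last first.
  apply: Hr; split; last exact: ballxx.
  rewrite /ball /= /t' opprD addrA subrr sub0r normrN normrM gtr0_norm //.
  apply: le_lt_trans kr; rewrite ler_pM2l // ler_norml.
  by apply/andP; split; lra.
have h1 : 0 <= (1 - k) * t by rewrite mulr_ge0 // subr_ge0; lra.
have h2 : 0 <= (1 - k) * (T - t) by rewrite mulr_ge0 // subr_ge0 //; lra.
have h3 : 0 < k * T by rewrite mulr_gt0.
by split=> //=; rewrite /t'; apply/andP; split; lra.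
Qed.

(** The representative x' is x itself in a bounded domain and a point of the cell in the periodic
    case. It must not depend on t, since values at two times are compared. *)
Lemma time_uniform_of_compact (K : set (R * V)) (g : R * V -> R) :
  compact K -> K `<=` closure Q -> {within closure Q, continuous g} ->
  (forall x, region s x -> exists2 x', region s x' &
    forall t, 0 < t < T -> K (t, x') /\ g (t, x') = g (t, x)) ->
  time_uniform (fun t x => g (t, x)).
Proof.
move=> Kc KQ gc rep; split.
  have [M M0 HM] := bounded_on_compact Kc (continuous_subspaceW KQ gc).
  exists M => // t x tT Dx; have [x' _ /(_ t tT) [Kx <-]] := rep x Dx.
  exact: HM.
move=> eta eta0; have := uniform_on_compact Kc KQ gc eta0.
apply: filterS => dt Hdt t x r t0 tr rd Dx.
have /andP[r0 _] := rd.
have tT : 0 < t < T by apply/andP; split=> //; lra.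
have trT : 0 < t + r < T by apply/andP; split=> //; lra.
have [x' Dx' Hx'] := rep x Dx.
have [Kx <-] := Hx' t tT; have [_ <-] := Hx' _ trT.
by apply: (Hdt (t, x') Kx r rd); apply: subset_closure.
Qed.

End TimeUniformContinuity.

Section TimeUniformFields.
Context {R : realType} {d : nat}.
Notation V := 'rV[R]_d.

Lemma time_uniform_continuous (s : setting R d) (T : R) (g : R * V -> R) :
  setting_ok s -> 0 < T -> {within closure (space_time s T), continuous g} ->
  (forall t, 0 < t < T -> field_on s (fun x => g (t, x))) ->
  time_uniform s T (fun t x => g (t, x)).
Proof.
move=> ok T0 gc gp.
have cT : compact `[0, T]%classic by exact: segment_compact.
case: s ok gc gp => [Om [[oO _ bO _] _]|L L0] gc gp.
  apply: (@time_uniform_of_compact R d _ T (closure (space_time (NoSlip Om) T)) g _ _ gc).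
  - have [B B0 OB] := bounded_in_cube bO.
    have Kc : compact (`[0, T]%classic `*` (cube 0 B : set V)).
      by apply: compact_setX => //; exact: compact_cube.
    apply: (subclosed_compact _ Kc); first exact: closed_closure.
    have Kcl : closed (`[0, T]%classic `*` (cube 0 B : set V)).
      by apply: compact_closed Kc; exact: norm_hausdorff.
    have sub : space_time (NoSlip Om) T `<=` `[0, T]%classic `*` (cube 0 B : set V).
      move=> [t x] [/= /andP[t0 tT] Ox].
      by split; [rewrite /= in_itv /= !ltW | exact: OB].
    by have := closureS sub; rewrite -((closure_id _).1 Kcl).
  - by [].
  - move=> x Ox; exists x => // t tT; split=> //.
    by apply: subset_closure.
pose K : set (R * V) := `[0, T]%classic `*` [set x : V | forall i, (0 : V) 0 i <= x 0 i <= L 0 i].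
apply: (@time_uniform_of_compact R d _ T K g _ _ gc).
- by apply: compact_setX => //; exact: compact_box.
- move=> [t x] [/=]; rewrite in_itv /= => tT _.
  by apply: closure_time.
- move=> x _; exists (cell_repr L x) => // t tT; split.
    split=> /=; last by move=> i; rewrite [(0 : V) 0 i]mxE; exact: cell_repr_itv.
    by rewrite in_itv /=; have /andP[? ?] := tT; apply/andP; split; exact: ltW.
  by apply: (@periodic_cell_repr R d L (fun x => g (t, x))); exact: gp.
Qed.

Lemma is_derive_translate (W : normedModType R) (f : W -> R) (z w v : W) df :
  is_derive (z + w) v f df -> is_derive z v (fun y => f (y + w)) df.
Proof.
move=> [fd fe].
have E : (fun k : R => k^-1 *: (f (k *: v + z + w) - f (z + w)))
    = (fun k : R => k^-1 *: (f (k *: v + (z + w)) - f (z + w))).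
  by apply/funext => k; rewrite addrA.
apply: DeriveDef; first by rewrite /derivable /= E.
by rewrite /derive /= E.
Qed.

Lemma is_derive_slice_space (f : R -> V -> R) (t : R) (x v : V) df :
  is_derive ((t, x) : R * V) ((0, v) : R * V) (fun z => f z.1 z.2) df ->
  is_derive x v (f t) df.
Proof.
move=> [fd fe].
have E : (fun k : R => k^-1 *: (f t (k *: v + x) - f t x))
    = (fun k : R => k^-1 *: (f (k *: (0 : R) + t) (k *: v + x) - f t x)).
  by apply/funext => k; rewrite scaler0 add0r.
apply: DeriveDef; first by rewrite /derivable /= E.
by rewrite /derive /= E.
Qed.

Lemma is_derive_slice_time (f : R -> V -> R) (t : R) (x : V) df :
  is_derive ((t, x) : R * V) ((1, 0) : R * V) (fun z => f z.1 z.2) df ->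
  is_derive t 1 (fun r => f r x) df.
Proof.
move=> [fd fe].
have E : (fun k : R => k^-1 *: (f (k *: (1 : R) + t) x - f t x))
    = (fun k : R => k^-1 *: (f (k *: (1 : R) + t) (k *: (0 : V) + x) - f t x)).
  by apply/funext => k; rewrite scaler0 add0r.
apply: DeriveDef; first by rewrite /derivable /= E.
by rewrite /derive /= E.
Qed.

Lemma time_uniform_C1 (s : setting R d) (T : R) (f : R -> V -> R) :
  setting_ok s -> 0 < T ->
  Ck (space_time s T) (closure (space_time s T)) 1 (fun z : R * V => f z.1 z.2) ->
  (forall t, 0 <= t <= T -> field_on s (f t)) ->
  [/\ time_uniform s T f, forall i, time_uniform s T (fun t x => pd i (f t) x),
      time_uniform s T (fun t x => 'D_1 (fun r : R => f r x) t)
    & forall t x, 0 < t < T -> region s x ->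
        (forall i, derivable (f t) x (unitv i)) /\ derivable (fun r : R => f r x) t 1].
Proof.
move=> ok T0 [fc fd] fp.
pose F (z : R * V) := f z.1 z.2.
have fp' t : 0 < t < T -> field_on s (f t).
  by move=> /andP[? ?]; apply: fp; apply/andP; split; exact: ltW.
have key (v : R * V) : exists2 g : R * V -> R, time_uniform s T (fun t x => g (t, x)) &
    forall t x, 0 < t < T -> region s x -> is_derive ((t, x) : R * V) v F (g (t, x)).
  have [g [[gc _] gd]] := fd v; exists g; last by move=> t x tT Dx; exact: gd.
  apply: time_uniform_continuous => // t tT.
  case: s ok fc fd fp fp' gc gd => [//|L] ok fc fd fp fp' gc gd x i.
  have D1 : is_derive ((t, x) + (0, L 0 i *: unitv i) : R * V) v F (g (t, x + L 0 i *: unitv i)).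
    have -> : ((t, x) + (0, L 0 i *: unitv i) : R * V) = (t, x + L 0 i *: unitv i).
      by congr (_, _); rewrite /= addr0.
    by apply: gd.
  have D2 := is_derive_translate D1.
  (* Periodicity is known only for times between 0 and T, so f agrees with its translate only near
     (t, x); this suffices for the derivatives to agree. *)
  have nf : {near ((t, x) : R * V), (fun y : R * V => F (y + (0, L 0 i *: unitv i))) =1 F}.
    have /andP[t0 tT'] := tT.
    pose r := Num.min t (T - t); have r0 : 0 < r by rewrite lt_min t0 subr_gt0.
    apply/nbhs_ballP; exists r => //= -[t' x'] [/= tt' _].
    have tT2 : 0 < t' < T.
      move: tt'; rewrite /ball /= /r lt_min !ltr_norml => /andP[/andP[? ?] /andP[? ?]].
      by apply/andP; split; lra.
    by rewrite /F /= addr0 (fp' t' tT2).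
  have [_ <-] := near_eq_is_derive nf D2.
  by have [_ <-] := gd (t, x) (conj tT I).
have ft : time_uniform s T f.
  apply: (@time_uniform_eq R d s T (fun t x => F (t, x)) f) => //.
  by apply: time_uniform_continuous.
split=> //.
- move=> i; have [g gu gd] := key (0, unitv i).
  apply: time_uniform_eq gu => t x tT Dx.
  by have [_ <-] := is_derive_slice_space (gd t x tT Dx).
- have [g gu gd] := key (1, 0); apply: time_uniform_eq gu => t x tT Dx.
  by have [_ <-] := is_derive_slice_time (gd t x tT Dx).
- move=> t x tT Dx; split=> [i|].
    have [g gu gd] := key (0, unitv i).
    by have [] := is_derive_slice_space (gd t x tT Dx).
  have [g gu gd] := key (1, 0).
  by have [] := is_derive_slice_time (gd t x tT Dx).
Qed.

End TimeUniformFields.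

Section Consistency.
Context {R : realType} {d : nat}.
Notation V := 'rV[R]_d.

Lemma row_norm_le (v : V) (e : R) : 0 <= e -> (forall i, `|v 0 i| <= e) -> `|v| <= e.
Proof.
move=> e0 H; rewrite [leLHS]/Num.Def.normr /= mx_normrE; apply: bigmax_le => // -[i j] _.
by rewrite /= (ord1 i).
Qed.

Lemma triple_norm_lt (a c : R) (v : V) (e : R) : `|a| < e -> `|c| < e -> `|v| < e ->
  `|(a, c, v) : R * R * V| < e.
Proof. by move=> ae ce ve; rewrite !prod_normE /= !gt_max ae ce ve. Qed.

Lemma time_mvt (f df : R -> R) (t r : R) : 0 < r ->
  (forall q, t <= q <= t + r -> is_derive q 1 f (df q)) ->
  exists2 q, 0 <= q <= r & r^-1 * (f (t + r) - f t) = df (t + q).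
Proof.
move=> r0 fd.
have fd' q : 0 <= q <= r -> is_derive (t + q *: (1 : R)) 1 f (df (t + q *: (1 : R))).
  move=> /andP[q0 qr]; rewrite [q *: 1]mulr1; apply: fd.
  by rewrite lerDl q0 lerD2l.
have [s sr] := mvt_line (ltW r0) fd'; rewrite [r *: 1]mulr1 [s *: 1]mulr1 => E.
by exists s => //; rewrite E mulKf // gt_eqF.
Qed.

(** In the difference of the operators b, H0 and the advection cancel. What remains are time
    increments of the divergence, the depth and the pressure gradient, and a difference quotient
    minus a time derivative. *)
Lemma lake_consistent (s : setting R d) (b : V -> R) (H0 : R) : setting_ok s ->
  consistent s (lake_step_op b H0) (lake_op b H0).
Proof.
move=> ok T h u p Q T0 hC uC pC bc eta eta0.
have hf t : 0 <= t <= T -> field_on s (h t).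
  by move=> /bc [+ _]; case: (s) => [//|L] [].
have uf i t : 0 <= t <= T -> field_on s (fun x => u t x 0 i).
  by move=> /bc [+ _]; case: (s) => [//|L] [_ pu] x j; rewrite pu.
have pf t : 0 <= t <= T -> field_on s (p t) by move=> /bc [].
have [hU hdU htU hD] := time_uniform_C1 ok T0 hC hf.
have uK i := @time_uniform_C1 R d s T (fun t x => u t x 0 i) ok T0 (Ck_coord i uC) (uf i).
have [pU pdU ptU pD] := time_uniform_C1 ok T0 pC pf.
(* [G1] and [G3] are the product rules for the divergence and the time derivative of the discharge,
   in terms of fields already known to be uniform in time. *)
pose G1 t x := \sum_i (h t x * pd i (fun y => u t y 0 i) x + u t x 0 i * pd i (h t) x).
pose W k t x := h t x * u t x 0 k.
pose G3 k t x := h t x * 'D_1 (fun r : R => u r x 0 k) t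
  + u t x 0 k * 'D_1 (fun r : R => h r x) t.
have G1U : time_uniform s T G1.
  apply: time_uniform_sum => i; have [ui udi uti _] := uK i.
  exact: (time_uniformD (time_uniformM hU (udi i)) (time_uniformM ui (hdU i))).
have G3U k : time_uniform s T (G3 k).
  have [ui udi uti _] := uK k.
  exact: (time_uniformD (time_uniformM hU uti) (time_uniformM ui htU)).
have WD k t x : 0 < t < T -> region s x -> is_derive t 1 (fun r : R => W k r x) (G3 k t x).
  move=> tT Dx; have [_ dh] := hD t x tT Dx; have [_ _ _ uD] := uK k.
  have [_ du] := uD t x tT Dx.
  by apply: DeriveDef; [exact: (derivableM dh du)|exact: (deriveM dh du)].
have divE t x : 0 < t < T -> region s x -> div (discharge (h t) (u t)) x = G1 t x.
  move=> tT Dx; rewrite div_dischargeE; apply: eq_bigr => i _.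
  have [dh _] := hD t x tT Dx; have [_ _ _ uD] := uK i; have [du _] := uD t x tT Dx.
  by rewrite (pdM (dh i) (du i)).
have [[M M0 HM] hU2] := hU.
have e2 : 0 < eta / 2 by rewrite divr_gt0.
have e8 : 0 < eta / 4 by rewrite divr_gt0.
(* The increment of the pressure gradient is multiplied by h, bounded by M. *)
have eM : 0 < eta / 4 / M by rewrite divr_gt0.
have nG3 : \forall dt \near (0 : R)^'+, forall k t x r, 0 < t -> t + r < T ->
    0 <= r <= dt -> region s x -> `|G3 k (t + r) x - G3 k t x| <= eta / 4.
  by apply: filter_forall => k; exact: (G3U k).2.
have nP : \forall dt \near (0 : R)^'+, forall k t x r, 0 < t -> t + r < T ->
    0 <= r <= dt -> region s x -> `|pd k (p (t + r)) x - pd k (p t) x| <= eta / 4 / M.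
  by apply: filter_forall => k; exact: (pdU k).2.
have FR : Filter (0^'+ : set_system R) by typeclasses eauto.
have A1 := @filterI _ _ FR _ _ (hU2 _ e2) (G1U.2 _ e2).
have A2 := @filterI _ _ FR _ _ nG3 nP.
apply: filterS3 A1 A2 (@nbhs_right_gt R 0) => dt [Ah AG1] [AG3 AP] dt0 t x t0 tdt Dx.
have rd : 0 <= dt <= dt by rewrite lexx ltW.
have tT : 0 < t < T by apply/andP; split=> //; lra.
have tdT : 0 < t + dt < T by apply/andP; split=> //; lra.
(* All estimates give non-strict bounds by eta / 2; this yields the strict one. *)
have lt2 : eta / 2 < eta by lra.
apply: (@triple_norm_lt
  (div (discharge (h (t + dt)) (u (t + dt))) x - div (discharge (h t) (u t)) x)
  (h (t + dt) x + b x - H0 - (h t x + b x - H0))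
  (dt^-1 *: (discharge (h (t + dt)) (u (t + dt)) x - discharge (h t) (u t) x)
      + advection (h t) (u t) x + h t x *: grad (p (t + dt)) x
    - ('D_1 (fun r : R => discharge (h r) (u r) x) t + advection (h t) (u t) x
      + h t x *: grad (p t) x)) eta).
- rewrite (divE _ _ tT Dx) (divE _ _ tdT Dx); apply: le_lt_trans lt2; exact: AG1.
- have -> : h (t + dt) x + b x - H0 - (h t x + b x - H0) = h (t + dt) x - h t x by ring.
  by apply: le_lt_trans lt2; exact: Ah.
- apply: le_lt_trans lt2; apply: row_norm_le => [|k]; first exact: ltW.
  have dD : 'D_1 (fun r : R => discharge (h r) (u r) x) t 0 k = G3 k t x.
    have dv : derivable (fun r : R => discharge (h r) (u r) x) t 1.
      apply/derivable_mxP => i j; rewrite (ord1 i).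
      have -> : (fun r : R => discharge (h r) (u r) x 0 j) = (fun r => W j r x).
        by apply/funext => r; rewrite mxE.
      by have [] := WD j t x tT Dx.
    rewrite (derive_mx dv) mxE.
    have -> : (fun r : R => discharge (h r) (u r) x 0 k) = (fun r => W k r x).
      by apply/funext => r; rewrite mxE.
    by have [_ ->] := WD k t x tT Dx.
  move: (advection (h t) (u t) x) => A.
  move: ('D_1 (fun r : R => discharge (h r) (u r) x) t) dD => D1 dD.
  have [|q qd E] := @time_mvt (fun r => W k r x) (fun r => G3 k r x) t dt dt0.
    by move=> q /andP[q1 q2]; apply: WD => //; apply/andP; split; lra.
  have -> : (dt^-1 *: (discharge (h (t + dt)) (u (t + dt)) x - discharge (h t) (u t) x)
      + A + h t x *: grad (p (t + dt)) x - (D1 + A + h t x *: grad (p t) x)) 0 k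
    = (G3 k (t + q) x - G3 k t x) + h t x * (pd k (p (t + dt)) x - pd k (p t) x).
    by rewrite -E -dD /W /discharge /grad !mxE; ring.
  have -> : eta / 2 = eta / 4 + M * (eta / 4 / M) by field; rewrite gt_eqF.
  apply: le_trans (ler_normD _ _) _; apply: lerD.
    by have /andP[? ?] := qd; apply: AG3 => //; lra.
  by rewrite normrM; apply: ler_pM => //; [exact: HM|exact: AP].
Qed.

End Consistency.

Theorem theorem3p2 (R : realType) (d : nat) (d_gt0 : (0 < d)%N)
    (mu : {measure set (borel R d) -> \bar R}) (mu_lebesgue : is_lebesgue mu)
    (s : setting R d) (s_ok : setting_ok s)
    (dt : R) (dt_gt0 : 0 < dt)
    (b : 'rV[R]_d -> R)
    (b_C2 : Ck (region s) (closure (region s)) 2 b) (b_on : field_on s b)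
    (h : R -> nat -> 'rV[R]_d -> R) (u : R -> nat -> 'rV[R]_d -> 'rV[R]_d)
    (h_ : nat -> nat -> 'rV[R]_d -> R)
    (u_ : nat -> nat -> 'rV[R]_d -> 'rV[R]_d)
    (hu_C2 : forall n, \forall eps \near 0^'+,
       Ck (region s) (closure (region s)) 2 (h eps n) /\
       Ck (region s) (closure (region s)) 2 (u eps n))
    (hu_bc : forall n, \forall eps \near 0^'+,
       boundary_condition s (h eps n) (u eps n))
    (no_dry : forall n, \forall eps \near 0^'+,
       forall x, region s x -> 0 < h eps n x)
    (no_dry0 : forall n x, region s x -> 0 < h_ n 0%N x)
    (scheme : forall n, \forall eps \near 0^'+,
       semi_implicit_step s mu b eps dt
         (h eps n) (u eps n) (h eps n.+1) (u eps n.+1))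
    (h_exp : forall n,
       asymptotic_expansion (region s) (fun eps => h eps n) (h_ n))
    (u_exp : forall n,
       vector_expansion (region s) (fun eps => u eps n) (u_ n)) :
  [/\ forall n, exists H0 : R, forall x, region s x -> h_ n.+1 0%N x + b x = H0,
      forall n (H0 : R), (forall x, region s x -> h_ n 0%N x + b x = H0) ->
        forall x, region s x ->
          lake_step_op b H0 dt (h_ n 0%N) (u_ n 0%N)
            (h_ n.+1 0%N) (u_ n.+1 0%N) (h_ n.+1 2%N) x = 0
    & forall H0 : R, consistent s (lake_step_op b H0) (lake_op b H0)].
Proof.
split.
- move=> n.
  exact: (limit_depth s_ok b_C2 hu_C2 no_dry no_dry0 scheme h_exp u_exp n).
- move=> n H0.
  exact: (limit_step d_gt0 s_ok dt_gt0 b_C2 hu_C2 hu_bc no_dry no_dry0 scheme h_exp u_exp).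
- by move=> H0; exact: lake_consistent.
Qed.
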